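(* Let $\beta>0$ and $u^\delta\in L^2(\omega\times(0,T))$. Let $\{u^\delta_\ell\}_{\ell\ge1}\subset L^2(\omega\times(0,T))$ be a sequence such that $u^\delta_\ell\to u^\delta$ in $L^2(0,T;L^2(\omega))$ as $\ell\to\infty$, and let $\{f^\ell\}_{\ell\ge1}$ be a sequence of minimizers of the problems $$\min_{f\in L^2(\Omega)}J_\ell(f),\qquad J_\ell(f):=\|u(f)-u^\delta_\ell\|_{L^2(\omega\times(0,T))}^2+\beta\|f\|_{L^2(\Omega)}^2,\qquad \ell=1,2,\ldots.$$ Then $\{f^\ell\}$ converges strongly in $L^2(\Omega)$ to the minimizer of $$\min_{f\in L^2(\Omega)}J(f),\qquad J(f):=\|u(f)-u^\delta\|_{L^2(\omega\times(0,T))}^2+\beta\|f\|_{L^2(\Omega)}^2.$$ Here $u(f)$ denotes the solution of $$\partial_t^\alpha u-\triangle u+u=f(x)\mu(t)\ \text{ in }\Omega\times(0,T),\qquad u(\cdot,0)=0\ \text{ in }\Omega,\qquad \partial_\nu u=0\ \text{ on }\partial\Omega\times(0,T).$$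
   Context: Setting: $T>0$, $d\in\{1,2,3\}$, $\Omega\subset\mathbb R^d$ is a bounded convex polygonal domain (polyhedral if $d=3$, an interval if $d=1$), $0<\alpha<1$, $\omega\subset\Omega$ is a nonempty open subdomain, $\mu\in L^\infty(0,T)$ is a given real function, and $\nu$ is the outward unit normal on $\partial\Omega$. Riemann–Liouville integral: $J_{0+}^{\gamma}g(t)=\frac1{\Gamma(\gamma)}\int_0^t\frac{g(s)}{(t-s)^{1-\gamma}}\,ds$ for $0<\gamma<1$. Caputo derivative: $\partial_t^\alpha g(t)=\frac1{\Gamma(1-\alpha)}\int_0^t\frac{g'(s)}{(t-s)^\alpha}\,ds=J_{0+}^{1-\alpha}g'(t)$; for less regular $g$ with $g(0)=0$ it is understood as $\frac{d}{dt}J_{0+}^{1-\alpha}g$. Fractional spaces: for a Hilbert space $X$, ${}_0H^\alpha(0,T;X)$ is $H^\alpha(0,T;X)$ if $0<\alpha<\frac12$; $\{g\in H^{1/2}(0,T;X):\int_0^T\|g(t)\|_X^2\,t^{-1}dt<\infty\}$ if $\alpha=\frac12$; $\{g\in H^\alpha(0,T;X):g(0)=0\}$ if $\frac12<\alpha<1$. Forward solution: for each $f\in L^2(\Omega)$ the initial-boundary value problem has a unique solution $u(f)\in{}_0H^\alpha(0,T;L^2(\Omega))\cap C([0,T];L^2(\Omega))\cap L^2(0,T;H^2(\Omega))$, and there is $C>0$ depending only on $\Omega,T,\alpha,\mu$ with $\|u(f)\|_{H^\alpha(0,T;L^2(\Omega))}+\|u(f)\|_{C([0,T];L^2(\Omega))}+\|u(f)\|_{L^2(0,T;H^2(\Omega))}\le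 C\|f\|_{L^2(\Omega)}$ (known result). Equivalently $u(f)$ satisfies $u(f)(\cdot,0)=0$ and $\int_0^T\int_\Omega(\partial_t^\alpha u(f)\,\varphi+\nabla u(f)\cdot\nabla\varphi+u(f)\varphi)\,dx\,dt=\int_0^T\int_\Omega f\mu\,\varphi\,dx\,dt$ for all $\varphi\in H^\alpha(0,T;L^2(\Omega))\cap L^2(0,T;H^1(\Omega))$. The minimizers of $J$ and of each $J_\ell$ over $L^2(\Omega)$ exist and are unique. *)

(* Defs.v *)
From HB Require Import structures.
From mathcomp Require Import all_boot all_order all_algebra.
From mathcomp Require Import all_classical all_reals all_analysis.

Set Implicit Arguments.
Unset Strict Implicit.
Unset Printing Implicit Defensive.
Import Order.TTheory GRing.Theory Num.Theory.
Import numFieldNormedType.Exports.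
Local Open Scope classical_set_scope.
Local Open Scope ring_scope.

Definition rV_display : measure_display -> measure_display.
Proof. exact. Qed.

(* Row vectors carry the product sigma-algebra, as n.-tuple does. *)
Section measurable_rV.
Context {d} {T : sigmaRingType d}.
Variable n : nat.

Let coors : 'I_n -> 'rV[T]_n -> T := fun i x => x ord0 i.

Let rV_set0 : g_sigma_preimage coors set0.
Proof. exact: sigma_algebra0. Qed.

Let rV_setC A : g_sigma_preimage coors A -> g_sigma_preimage coors (~` A).
Proof. exact: sigma_algebraC. Qed.

Let rV_bigcup (F : _^nat) : (forall i, g_sigma_preimage coors (F i)) ->
  g_sigma_preimage coors (\bigcup_i (F i)).
Proof. exact: sigma_algebra_bigcup. Qed.

HB.instance Definition _ := @isMeasurable.Build (rV_display d)
  'rV[T]_n (g_sigma_preimage coors) rV_set0 rV_setC rV_bigcup.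

End measurable_rV.

Section rV_cons.
Variable R : realType.

Definition rV_cons n (p : measurableTypeR R * 'rV[R]_n) : 'rV[R]_n.+1 :=
  row_mx (p.1)%:M p.2.

Definition rV_uncons n (x : 'rV[R]_n.+1) : measurableTypeR R * 'rV[R]_n :=
  (x ord0 ord0, \row_j x ord0 (lift ord0 j)).

Lemma rV_cons0 n (p : measurableTypeR R * 'rV[R]_n) : rV_cons p ord0 ord0 = p.1.
Proof.
transitivity (row_mx p.1%:M p.2 ord0 (lshift n (@ord0 0))).
  by congr (row_mx _ _ _ _); exact/val_inj.
by rewrite row_mxEl mxE eqxx mulr1n.
Qed.

Lemma rV_consS n (p : measurableTypeR R * 'rV[R]_n) j :
  rV_cons p ord0 (lift ord0 j) = p.2 ord0 j.
Proof.
transitivity (row_mx p.1%:M p.2 ord0 (rshift 1 j)); last by rewrite row_mxEr.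
by congr (row_mx _ _ _ _); exact/val_inj.
Qed.

Lemma rV_consK n : cancel (@rV_cons n) (@rV_uncons n).
Proof.
move=> [a v]; rewrite /rV_uncons rV_cons0 /=; congr pair.
by apply/rowP => j; rewrite mxE rV_consS.
Qed.

Lemma rV_unconsK n : cancel (@rV_uncons n) (@rV_cons n).
Proof.
move=> x; apply/rowP => i; case: (unliftP ord0 i) => [j|] ->.
  by rewrite rV_consS mxE.
by rewrite rV_cons0.
Qed.

Lemma measurable_coor n (i : 'I_n) :
  measurable_fun [set: 'rV[R]_n] (fun x => x ord0 i).
Proof.
move=> _ Y mY; rewrite setTI; apply: sub_sigma_algebra => /=.
rewrite -bigcup_seq/=; exists i => /=; first by rewrite mem_index_enum.
by exists Y => //; rewrite setTI.
Qed.

Lemma measurable_fun_rV d1 (T1 : measurableType d1) n (f : T1 -> 'rV[R]_n) :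
  (forall i, measurable_fun [set: T1] (fun x => f x ord0 i)) ->
  measurable_fun [set: T1] f.
Proof.
move=> mf _ Y mY; rewrite setTI.
suff : g_sigma_preimage (fun i (x : 'rV[R]_n) => x ord0 i) `<=`
    [set A | measurable (f @^-1` A)] by apply; exact: mY.
apply: smallest_sub.
  split => [|A /= mA|F /= mF].
  - by rewrite /= preimage_set0; exact: measurable0.
  - by rewrite setTD preimage_setC; exact: measurableC.
  - by rewrite preimage_bigcup; exact: bigcup_measurable.
rewrite -bigcup_seq; apply: bigcup_sub => i _ A [B mB <-] /=.
by rewrite setTI -comp_preimage -[X in measurable X]setTI; exact: mf.
Qed.

Lemma measurable_rV_cons n : measurable_fun setT (@rV_cons n).
Proof.
apply: measurable_fun_rV => i; case: (unliftP ord0 i) => [j|] ->.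
  apply: (eq_measurable_fun ((fun v : 'rV[R]_n => v ord0 j) \o snd)).
    by move=> x _; rewrite rV_consS.
  by apply: measurableT_comp; [exact: measurable_coor|exact: measurable_snd].
apply: (eq_measurable_fun fst); last exact: measurable_fst.
by move=> x _; rewrite rV_cons0.
Qed.

Lemma measurable_rV_uncons n : measurable_fun setT (@rV_uncons n).
Proof.
apply/measurable_fun_pairP; split => /=; first exact: measurable_coor.
apply: measurable_fun_rV => i /=.
apply: (eq_measurable_fun (fun x : 'rV[R]_n.+1 => x ord0 (lift ord0 i))).
  by move=> x _; rewrite mxE.
exact: measurable_coor.
Qed.

End rV_cons.

Lemma sigma_finite_measure_ex d (T : measurableType d) (R : realType)
    (P : set T -> \bar R) :
  P set0 = 0%E -> (forall A, (0 <= P A)%E) -> semi_sigma_additive P ->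
  sigma_finite setT P ->
  exists m : {sigma_finite_measure set T -> \bar R}, m = P :> (set T -> \bar R).
Proof.
move=> P0 Pge0 Padd sfP.
pose mP := isMeasure.Build _ _ _ P P0 Pge0 Padd.
pose Pm : {measure set T -> \bar R} := HB.pack P mP.
pose sP := @Measure_isSigmaFinite.Build _ _ _ Pm sfP.
pose Ps : {sigma_finite_measure set T -> \bar R} := HB.pack P mP sP.
by exists Ps.
Qed.

Section leb.
Variable R : realType.

Fixpoint leb_fun (n : nat) : set 'rV[R]_n -> \bar R :=
  match n return set 'rV[R]_n -> \bar R with
  | 0 => dirac (0 : 'rV[R]_0)
  | n'.+1 => pushforward (@lebesgue_measure R \x @leb_fun n')%E (@rV_cons R n')
  end.

Lemma leb_measure_ex n :
  exists m : {sigma_finite_measure set 'rV[R]_n -> \bar R},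
    m = @leb_fun n :> (set 'rV[R]_n -> \bar R).
Proof.
elim: n => [|n [m mE]].
  by exists (dirac (0 : 'rV[R]_0)).
pose P := pushforward (@lebesgue_measure R \x m)%E (@rV_cons R n).
have P0 : P set0 = 0%E by rewrite /P /pushforward preimage_set0 measure0.
have Pge0 A : (0 <= P A)%E by rewrite /P /pushforward; exact: measure_ge0.
have Padd : semi_sigma_additive P.
  move=> F mF tF mUF; rewrite /P /pushforward preimage_bigcup.
  apply: measure_semi_sigma_additive.
  - by move=> k; rewrite -[X in measurable X]setTI; exact: measurable_rV_cons.
  - apply/trivIsetP => /= i j _ _ ij; rewrite -preimage_setI.
    by move/trivIsetP : tF => /(_ _ _ _ _ ij) ->//; rewrite preimage_set0.
  - rewrite -preimage_bigcup -[X in measurable X]setTI.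
    exact: measurable_rV_cons.
rewrite /= -mE; apply: sigma_finite_measure_ex P0 Pge0 Padd _.
have [F [FT Ffin]] : exists F : (set (measurableTypeR R * 'rV[R]_n))^nat,
    setT = \bigcup_i F i /\ forall i, measurable (F i) /\
      ((@lebesgue_measure R \x m)%E (F i) < +oo)%E.
  have /sigma_finiteP[G [TG ndG Goo]] := sigma_finiteT (@lebesgue_measure R).
  have /sigma_finiteP[H [TH ndH Hoo]] := sigma_finiteT m.
  exists (fun k => G k `*` H k); split.
    rewrite -setXTT TG TH predeqE => -[x y]; split; last first.
      by move=> [k _ []/= ? ?]; split; exists k.
    move=> [/= [k _ Gx] [l _ Hy]]; exists (maxn k l) => //; split.
    - by move: x Gx; exact/subsetPset/ndG/leq_maxl.
    - by move: y Hy; exact/subsetPset/ndH/leq_maxr.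
  move=> k; have [? ?] := Goo k; have [? ?] := Hoo k.
  split; first exact: measurableX.
  by rewrite product_measure1E// lte_mul_pinfty// ge0_fin_numE.
exists (fun i => @rV_uncons R n @^-1` F i).
  by rewrite -preimage_bigcup -FT preimage_setT.
move=> i; have [mFi Fioo] := Ffin i; split.
  by rewrite -[X in measurable X]setTI; exact: measurable_rV_uncons.
rewrite /P /pushforward -comp_preimage.
by rewrite (_ : _ \o _ = id) //; apply/funext => x /=; exact: rV_consK.
Qed.

Definition leb n : set 'rV[R]_n -> \bar R := @leb_fun n.
Arguments leb : clear implicits.

Let leb0 n : leb n set0 = 0%E.
Proof. by rewrite /leb; have [m <-] := leb_measure_ex n; exact: measure0. Qed.

Let leb_ge0 n A : (0 <= leb n A)%E.
Proof. by rewrite /leb; have [m <-] := leb_measure_ex n; exact: measure_ge0. Qed.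

Let leb_semi_sigma_additive n : semi_sigma_additive (leb n).
Proof.
rewrite /leb; have [m <-] := leb_measure_ex n.
exact: measure_semi_sigma_additive.
Qed.

HB.instance Definition _ n := isMeasure.Build _ _ _ (leb n)
  (@leb0 n) (@leb_ge0 n) (@leb_semi_sigma_additive n).

Let leb_sigma_finite n : sigma_finite setT (leb n).
Proof.
by rewrite /leb; have [m <-] := leb_measure_ex n; exact: sigma_finiteT.
Qed.

HB.instance Definition _ n := Measure_isSigmaFinite.Build _ _ _ (leb n)
  (@leb_sigma_finite n).

End leb.
Arguments leb {R} n.


Section Lebesgue_spaces.
Context {R : realType} {disp : measure_display} {X : measurableType disp}.
Variable m : {measure set X -> \bar R}.

(* Elements are functions on the whole of X whose values outside D are
   irrelevant: f \_ D is f extended by 0 outside D. *)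
Definition in_Lp (p : \bar R) (D : set X) (f : X -> R) : Prop :=
  (f \_ D) \in Lfun m p.

Definition in_L2 (D : set X) (f : X -> R) : Prop := in_Lp 2%:E D f.

Definition L2norm (D : set X) (f : X -> R) : \bar R :=
  'N[m]_2%:E [EFin \o (f \_ D)].

End Lebesgue_spaces.

Section space.
Context {R : realType} {d : nat}.
Implicit Types (Omega : set 'rV[R]_d) (phi v g : 'rV[R]_d -> R).

(* Bounded convex polygonal (polyhedral, interval) domain: a nonempty bounded
   intersection of finitely many open half-spaces. *)
Definition convex_polytope_domain Omega : Prop :=
  [/\ Omega !=set0, bounded_set Omega &
      exists (k : nat) (a : 'I_k -> 'rV[R]_d) (b : 'I_k -> R),
        (forall j, a j != 0) /\
        Omega = [set x | forall j, \sum_(i < d) a j ord0 i * x ord0 i < b j]].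

Definition pderiv (i : 'I_d) phi : 'rV[R]_d -> R :=
  fun x => 'D_(delta_mx ord0 i) phi x.

Definition smooth phi : Prop :=
  forall (s : seq 'I_d) (x : 'rV[R]_d), differentiable (foldr pderiv phi s) x.

Definition test_function Omega phi : Prop :=
  smooth phi /\
  exists K, [/\ compact K, K `<=` Omega & forall x, ~ K x -> phi x = 0].

Definition weak_pderiv Omega (i : 'I_d) v g : Prop :=
  [/\ in_L2 (leb d) Omega v, in_L2 (leb d) Omega g &
      forall phi, test_function Omega phi ->
        \int[leb d]_(x in Omega) (v x * pderiv i phi x) =
        - \int[leb d]_(x in Omega) (g x * phi x)].

End space.

Section time.
Context {R : realType}.
Implicit Types (psi g : R -> R).

Definition time_test_function (T : R) psi : Prop :=
  (forall n t, derivable (derive1n n psi) t 1) /\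
  exists K, [/\ compact K, K `<=` `]0, T[ & forall t, ~ K t -> psi t = 0].

Definition Gamma (x : R) : R :=
  \int[lebesgue_measure]_(s in `]0, +oo[) (s `^ (x - 1) * expR (- s)).

Definition RL_integral (gamma : R) g (t : R) : R :=
  (Gamma gamma)^-1 *
  \int[lebesgue_measure]_(s in `]0, t[) (g s / (t - s) `^ (1 - gamma)).

End time.

Section space_time.
Context {R : realType} {d : nat}.
Variables (Omega : set 'rV[R]_d) (T : R).

(* L^2(0,T;L^2(Omega)) is L^2(Omega x (0,T)): an L^2(Omega)-valued function of
   time is a jointly measurable function of (x, t). *)
Notation Qtype := ('rV[R]_d * measurableTypeR R)%type.
Implicit Types (u v w phi : Qtype -> R).

Definition leb_xt : set Qtype -> \bar R := (leb d \x @lebesgue_measure R)%E.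
HB.instance Definition _ := Measure.on leb_xt.

Definition cylinder (D : set 'rV[R]_d) : set Qtype := D `*` `]0, T[.
Local Notation Q := (cylinder Omega).

Definition slice u (t : R) : 'rV[R]_d -> R := fun x => u (x, t).

Definition in_C_L2 u : Prop :=
  (forall t, t \in `[0, T] -> in_L2 (leb d) Omega (slice u t)) /\
  (forall t, t \in `[0, T] ->
    L2norm (leb d) Omega (slice u s \- slice u t)
      @[s --> within `[0, T] (nbhs t)] --> 0%E).

Definition C_L2_norm u : \bar R :=
  ereal_sup [set L2norm (leb d) Omega (slice u t) | t in `[0, T]].

(* Square of the Sobolev-Slobodeckij seminorm of H^alpha(0,T; L^2(Omega)) *)
Definition Halpha_seminorm2 (alpha : R) u : \bar R :=
  (\int[lebesgue_measure]_(t in `]0%R, T[)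
     \int[lebesgue_measure]_(s in `]0%R, T[)
       (L2norm (leb d) Omega (slice u t \- slice u s)%R ^+ 2 *
        (`|t - s| `^ (- (1 + 2 * alpha)))%:E))%E.

Definition Halpha_norm (alpha : R) u : \bar R :=
  ((L2norm leb_xt Q u ^+ 2 + Halpha_seminorm2 alpha u) `^ 2^-1)%E.

Definition in_Halpha (alpha : R) u : Prop :=
  in_L2 leb_xt Q u /\ (Halpha_seminorm2 alpha u < +oo)%E.

(* For 1/2 < alpha, the value at time 0 is that of the continuous
   representative. *)
Definition in_0Halpha (alpha : R) u : Prop :=
  [/\ in_Halpha alpha u,
      (alpha = 2^-1 ->
        (\int[lebesgue_measure]_(t in `]0%R, T[)
           (L2norm (leb d) Omega (slice u t) ^+ 2 * (t^-1)%:E) < +oo)%E) &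
      (2^-1 < alpha ->
        exists v, [/\ in_C_L2 v, ae_eq leb_xt Q u v &
                      ae_eq (leb d) Omega (slice v 0) (cst 0)])].

Definition weak_dx (i : 'I_d) u (g : Qtype -> R) : Prop :=
  [/\ in_L2 leb_xt Q u, in_L2 leb_xt Q g &
      {ae lebesgue_measure, forall t, t \in `]0, T[ ->
        weak_pderiv Omega i (slice u t) (slice g t)}].

(* u is in L^2(0,T;H^1(Omega)), with gradient g *)
Definition L2H1_grad u (g : 'I_d -> Qtype -> R) : Prop :=
  in_L2 leb_xt Q u /\ forall i, weak_dx i u (g i).

(* u is in L^2(0,T;H^2(Omega)), with gradient g and Hessian H *)
Definition L2H2_hess u (g : 'I_d -> Qtype -> R) (H : 'I_d -> 'I_d -> Qtype -> R)
    : Prop :=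
  L2H1_grad u g /\ forall i, L2H1_grad (g i) (H i).

(* Weak derivatives are unique almost everywhere, so the infimum is over at most
   one value; it is +oo outside L^2(0,T;H^2(Omega)). *)
Definition L2H2_norm u : \bar R :=
  ereal_inf [set N | exists g H, L2H2_hess u g H /\
    N = ((L2norm leb_xt Q u ^+ 2 +
          \sum_(i < d) L2norm leb_xt Q (g i) ^+ 2 +
          \sum_(i < d) \sum_(j < d) L2norm leb_xt Q (H i j) ^+ 2) `^ 2^-1)%E].

(* w is the weak derivative in time of v, as L^2(Omega)-valued functions *)
Definition weak_dt v w : Prop :=
  [/\ in_L2 leb_xt Q v, in_L2 leb_xt Q w &
      forall psi, time_test_function T psi ->
        {ae leb d, forall x, Omega x ->
          \int[lebesgue_measure]_(t in `]0, T[) (v (x, t) * derive1 psi t) =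
          - \int[lebesgue_measure]_(t in `]0, T[) (w (x, t) * psi t)}].

(* w = d/dt J_{0+}^{1 - alpha} u; the first clause says that the fractional
   integral is a convergent Lebesgue integral almost everywhere. *)
Definition caputo (alpha : R) u w : Prop :=
  {ae leb_xt, forall z, Q z ->
    lebesgue_measure.-integrable `]0, z.2[
      (fun s : R => (u (z.1, s) / (z.2 - s) `^ alpha)%:E)} /\
  weak_dt (fun z => RL_integral (1 - alpha) (fun s => u (z.1, s)) z.2) w.

Variables (alpha : R) (mu : R -> R).

Definition weak_formulation (f : 'rV[R]_d -> R) u : Prop :=
  exists w g, [/\ caputo alpha u w, L2H1_grad u g &
    forall phi h, in_Halpha alpha phi -> L2H1_grad phi h ->
      \int[leb_xt]_(z in Q)
        (w z * phi z + \sum_(i < d) g i z * h i z + u z * phi z) =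
      \int[leb_xt]_(z in Q) (f z.1 * mu z.2 * phi z)].

(* The homogeneous Neumann condition is encoded by the test functions phi being
   unconstrained on the boundary. *)
Definition is_solution (f : 'rV[R]_d -> R) u : Prop :=
  [/\ in_0Halpha alpha u, in_C_L2 u, (exists g H, L2H2_hess u g H),
      ae_eq (leb d) Omega (slice u 0) (cst 0) & weak_formulation f u].

Definition well_posed : Prop :=
  [/\ (forall f, in_L2 (leb d) Omega f -> exists u, is_solution f u),
      (forall f u v, in_L2 (leb d) Omega f ->
         is_solution f u -> is_solution f v -> ae_eq leb_xt Q u v) &
      (exists C : R, 0 < C /\ forall f u, in_L2 (leb d) Omega f ->
         is_solution f u ->
         (Halpha_norm alpha u + C_L2_norm u + L2H2_norm u <=
          C%:E * L2norm (leb d) Omega f)%E)].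

(* u(f), determined up to null sets when the problem is well posed *)
Definition forward (f : 'rV[R]_d -> R) : Qtype -> R :=
  xget (cst 0) [set u | is_solution f u].

Definition J (omega : set 'rV[R]_d) (beta : R) (ud : Qtype -> R)
    (f : 'rV[R]_d -> R) : \bar R :=
  (L2norm leb_xt (cylinder omega) (forward f \- ud)%R ^+ 2 +
   beta%:E * L2norm (leb d) Omega f ^+ 2)%E.

End space_time.
Arguments leb_xt {R d}.

Definition is_minimizer {R : realType} {d : nat} (Omega : set 'rV[R]_d)
    (F : ('rV[R]_d -> R) -> \bar R) (f : 'rV[R]_d -> R) : Prop :=
  in_L2 (leb d) Omega f /\ forall g, in_L2 (leb d) Omega g -> (F f <= F g)%E.

(* Main.v *)
Require Import Defs.
From HB Require Import structures.
From mathcomp Require Import all_boot all_order all_algebra.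
From mathcomp Require Import all_classical all_reals all_analysis.
From mathcomp Require Import measurable_realfun ess_sup_inf.
From mathcomp Require Import zify ring lra.
Set Implicit Arguments.
Unset Strict Implicit.
Unset Printing Implicit Defensive.
Import Order.TTheory GRing.Theory Num.Theory.
Import numFieldNormedType.Exports.
Local Open Scope classical_set_scope.
Local Open Scope ring_scope.

(** The theorem is the stability of Tikhonov regularisation for the linear
    bounded observation operator f |-> u(f) restricted to omega x (0,T).

    Write A f for the forward solution, N for the L2 norm on Omega, M for the
    L2 norm on omega x (0,T), and J_w(f) = M (A f - w)^2 + beta N f^2.  The
    problem is linear, so uniqueness of solutions makes A linear up to null
    sets, and the parallelogram law then makes J_w strongly convex: if f
    minimises J_w, then beta/2 N (f - g)^2 <= J_w(g) - J_w(f) for every g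
    (minimizer_strong).  Adding this inequality for two data w, v with
    minimisers f, g cancels the penalties and gives
    beta N (f - g)^2 <= 2 M (w - v) (M (A 0 - w) + M (A 0 - v) + M (w - v))
    (minimizer_stability), where the misfits at the minimisers are bounded by
    comparing with f = 0.  Hence the minimisers for a convergent sequence of
    data form a Cauchy sequence, which has a limit because L2 is complete
    (L2_complete).  The energy estimate makes A continuous, so one can pass to
    the limit in J_(v_n)(f_n) <= J_(v_n)(g) and the limit minimises J_ud
    (limit_is_minimizer).  Strong convexity also shows that this minimiser is
    unique (minimizer_unique).

    The remaining work is the linearity of the notion of solution
    (is_solution_lin).  The weak derivatives and the weak formulation are
    linear as soon as the integrals in them converge, which is a matter of
    products of L2 functions.  The Gagliardo seminorm and the Hardy integral
    need the joint measurability of their integrands, since integrals of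
    non-measurable functions are not subadditive.  The fractional integral of
    a linear combination is the linear combination of the fractional integrals
    only at the points where both converge, that is almost everywhere, so its
    measurability has to be proved on the whole cylinder
    (measurable_frac_integral) and weak time derivatives have to be insensitive
    to null sets (weak_dt_ae_eq). *)

(** * Integral calculus in L2 *)

(** Every closure property below is stated for a f + b g at once, since both the
    midpoint and the difference of two functions are needed. *)
Definition lin {R : realType} {X : Type} (a : R) (f : X -> R) (b : R)
  (g : X -> R) : X -> R := fun x => a * f x + b * g x.

Section L2_calculus.
Context {R : realType} {disp : measure_display} {X : measurableType disp}.
Variable m : {measure set X -> \bar R}.
Implicit Types (D : set X) (f g h : X -> R) (a b : R).

Lemma restrictE D f x : (f \_ D) x = if x \in D then f x else 0.
Proof. by rewrite patchE. Qed.

Lemma restrict_lin D a f b g : (lin a f b g) \_ D = lin a (f \_ D) b (g \_ D).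
Proof.
by apply/funext => x; rewrite /lin !restrictE; case: ifP => // _; ring.
Qed.

Lemma restrictM D f g : (f \* g) \_ D = (f \_ D) \* (g \_ D).
Proof.
by apply/funext => x; rewrite /= !restrictE; case: ifP => // _; rewrite mul0r.
Qed.

Lemma linB f g : f \- g = lin 1 f (-1) g.
Proof. by apply/funext => x; rewrite /lin /= mul1r mulN1r. Qed.

Lemma measurable_lin D a f b g : measurable_fun D f -> measurable_fun D g ->
  measurable_fun D (lin a f b g).
Proof.
move=> mf mg; apply: measurable_funD; apply: measurable_funM => //.
Qed.

Lemma in_L2_measurable D f : in_L2 m D f -> measurable_fun setT (f \_ D).
Proof. by rewrite /in_L2 /in_Lp inE => /andP[/[!inE]]. Qed.

Lemma in_L2_lt_pinfty D f : in_L2 m D f -> (L2norm m D f < +oo)%E.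
Proof. by rewrite /in_L2 /in_Lp inE => /andP[_ /[!inE]]. Qed.

Lemma L2norm_ge0 D f : (0 <= L2norm m D f)%E.
Proof. exact: Lnorm_ge0. Qed.

Lemma in_L2_fin_num D f : in_L2 m D f -> L2norm m D f \is a fin_num.
Proof. by move=> /in_L2_lt_pinfty ?; rewrite ge0_fin_numE// L2norm_ge0. Qed.

Lemma sqr_L2norm D f :
  (L2norm m D f ^+ 2 = \int[m]_x (((f \_ D) x) ^+ 2)%:E)%E.
Proof.
have -> : (L2norm m D f ^+ 2 = L2norm m D f `^ 2)%E.
  have := L2norm_ge0 D f; case: (L2norm m D f) => [r||]//= r0.
    by rewrite -[LHS]/(r%:E * r%:E)%E -EFinM powR_mulrn// expr2.
  by rewrite mulyy /= pnatr_eq0.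
rewrite /L2norm poweR_Lnorm ?pnatr_eq0//; apply: eq_integral => x _ /=.
by rewrite powR_mulrn ?normr_ge0// -normrX ger0_norm// sqr_ge0.
Qed.

Lemma sqr_L2norm_ge0 D f : (0 <= L2norm m D f ^+ 2)%E.
Proof. by rewrite expe2 mule_ge0 ?L2norm_ge0. Qed.

Lemma in_L2P D f : in_L2 m D f <->
  measurable_fun setT (f \_ D) /\ (\int[m]_x (((f \_ D) x) ^+ 2)%:E < +oo)%E.
Proof.
split=> [fD|[mf foo]].
  split; first exact: in_L2_measurable.
  by rewrite -sqr_L2norm expe2 lte_mul_pinfty ?L2norm_ge0 ?in_L2_fin_num ?in_L2_lt_pinfty.
rewrite /in_L2 /in_Lp inE; apply/andP; split; rewrite inE//= /finite_norm.
move: foo; rewrite -sqr_L2norm expe2 -/(L2norm m D f).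
have := L2norm_ge0 D f; case: (L2norm m D f) => [r||]//=.
by move=> _ _; exact: ltry.
Qed.

(** Extended-real values are allowed because the lemma has to propagate
    finiteness through integrands that are themselves integrals. *)
Lemma ge0_le_lin_integral (f g h : X -> \bar R) (a b : R) : 0 <= a -> 0 <= b ->
  (forall x, 0 <= f x)%E -> (forall x, 0 <= g x)%E -> (forall x, 0 <= h x)%E ->
  measurable_fun setT f -> measurable_fun setT g -> measurable_fun setT h ->
  (forall x, h x <= a%:E * f x + b%:E * g x)%E ->
  (\int[m]_x h x <= a%:E * \int[m]_x f x + b%:E * \int[m]_x g x)%E.
Proof.
move=> a0 b0 f0 g0 h0 mf mg mh hfg.
have ma : measurable_fun setT (fun x => a%:E * f x)%E by exact: measurable_funeM.
have mb : measurable_fun setT (fun x => b%:E * g x)%E by exact: measurable_funeM.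
rewrite -!ge0_integralZl// -ge0_integralD//; last 2 first.
- by move=> x _; rewrite mule_ge0.
- by move=> x _; rewrite mule_ge0.
by apply: ge0_le_integral => //; exact: emeasurable_funD.
Qed.

Lemma lin_lty (a b : R) (x y : \bar R) : 0 <= a -> 0 <= b ->
  (0 <= x < +oo)%E -> (0 <= y < +oo)%E -> (a%:E * x + b%:E * y < +oo)%E.
Proof.
move=> a0 b0 /andP[x0 xoo] /andP[y0 yoo].
by apply: lte_add_pinfty; apply: lte_mul_pinfty.
Qed.

Lemma lee_lin_mulr (a b : R) (x y z w : \bar R) : 0 <= a -> 0 <= b ->
  (0 <= x)%E -> (0 <= y)%E -> (0 <= w)%E -> (z <= a%:E * x + b%:E * y)%E ->
  (z * w <= a%:E * (x * w) + b%:E * (y * w))%E.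
Proof.
move=> a0 b0 x0 y0 w0 zxy; rewrite !muleA -ge0_muleDl ?mule_ge0//.
exact: lee_wpmul2r.
Qed.

Lemma lin_integral_lty (f g h : X -> \bar R) (a b : R) : 0 <= a -> 0 <= b ->
  (forall x, 0 <= f x)%E -> (forall x, 0 <= g x)%E -> (forall x, 0 <= h x)%E ->
  measurable_fun setT f -> measurable_fun setT g -> measurable_fun setT h ->
  (forall x, h x <= a%:E * f x + b%:E * g x)%E ->
  (\int[m]_x f x < +oo)%E -> (\int[m]_x g x < +oo)%E ->
  (\int[m]_x h x < +oo)%E.
Proof.
move=> a0 b0 f0 g0 h0 mf mg mh hfg foo goo.
apply: le_lt_trans (ge0_le_lin_integral a0 b0 f0 g0 h0 mf mg mh hfg) _.
by apply: lin_lty; rewrite // ?foo ?goo integral_ge0.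
Qed.

Lemma le_sqr_lin a x b y :
  (a * x + b * y) ^+ 2 <= 2 * a ^+ 2 * x ^+ 2 + 2 * b ^+ 2 * y ^+ 2 :> R.
Proof. by have := sqr_ge0 (a * x - b * y); nra. Qed.

Lemma sqr_L2norm_lin_le D a f b g :
  measurable_fun setT (f \_ D) -> measurable_fun setT (g \_ D) ->
  (L2norm m D (lin a f b g) ^+ 2 <=
   (2 * a ^+ 2)%:E * L2norm m D f ^+ 2 + (2 * b ^+ 2)%:E * L2norm m D g ^+ 2)%E.
Proof.
move=> mf mg; rewrite !sqr_L2norm restrict_lin.
have msq h : measurable_fun setT h -> measurable_fun setT (fun x : X => (h x ^+ 2)%:E).
  by move=> mh; apply/measurable_EFinP; exact: measurable_funX.
apply: ge0_le_lin_integral.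
- by rewrite mulr_ge0 ?sqr_ge0.
- by rewrite mulr_ge0 ?sqr_ge0.
- by move=> x; rewrite lee_fin sqr_ge0.
- by move=> x; rewrite lee_fin sqr_ge0.
- by move=> x; rewrite lee_fin sqr_ge0.
- exact: msq.
- exact: msq.
- by apply: msq; exact: measurable_lin.
- by move=> x; rewrite -!EFinM -EFinD lee_fin; exact: le_sqr_lin.
Qed.

Lemma in_L2_lin D a f b g : in_L2 m D f -> in_L2 m D g ->
  in_L2 m D (lin a f b g).
Proof.
move=> /in_L2P[mf foo] /in_L2P[mg goo]; apply/in_L2P; split.
  by rewrite restrict_lin; exact: measurable_lin.
rewrite -sqr_L2norm; apply: le_lt_trans (sqr_L2norm_lin_le _ _ mf mg) _.
apply: lin_lty; [by rewrite mulr_ge0 ?sqr_ge0|by rewrite mulr_ge0 ?sqr_ge0| |];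
  by rewrite sqr_L2norm_ge0 sqr_L2norm.
Qed.

Lemma integrable_mul D f g : measurable D -> in_L2 m D f -> in_L2 m D g ->
  m.-integrable D (EFin \o (f \* g)).
Proof.
move=> mD fD gD; apply/(integrable_mkcond _ mD).
rewrite restrict_EFin restrictM; apply/Lfun1_integrable.
exact: Lfun2_mul_Lfun1.
Qed.

Definition L2n D f : R := fine (L2norm m D f).

Definition L2dot D f g : R := \int[m]_x ((f \_ D) x * (g \_ D) x).

Lemma L2n_ge0 D f : 0 <= L2n D f.
Proof. by rewrite fine_ge0// L2norm_ge0. Qed.

Lemma L2nE D f : in_L2 m D f -> L2norm m D f = (L2n D f)%:E.
Proof. by move=> fD; rewrite fineK// in_L2_fin_num. Qed.

Lemma sqr_L2n D f : in_L2 m D f -> L2n D f ^+ 2 = L2dot D f f.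
Proof.
move=> fD; rewrite /L2dot /Rintegral.
under eq_integral do rewrite -expr2.
by rewrite -sqr_L2norm L2nE.
Qed.

Lemma sqr_L2n_lin D a f b g : in_L2 m D f -> in_L2 m D g ->
  L2n D (lin a f b g) ^+ 2 =
  a ^+ 2 * L2n D f ^+ 2 + 2 * (a * b) * L2dot D f g + b ^+ 2 * L2n D g ^+ 2.
Proof.
move=> fD gD; rewrite !sqr_L2n//; last exact: in_L2_lin.
have I h1 h2 : in_L2 m D h1 -> in_L2 m D h2 ->
    m.-integrable setT (EFin \o (fun x => (h1 \_ D) x * (h2 \_ D) x)).
  by move=> ? ?; apply/Lfun1_integrable; exact: Lfun2_mul_Lfun1.
have Z c h1 h2 : in_L2 m D h1 -> in_L2 m D h2 ->
    m.-integrable setT (EFin \o (fun x => c * ((h1 \_ D) x * (h2 \_ D) x))).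
  move=> ? ?; rewrite (_ : _ \o _ = fun x => (c%:E * ((h1 \_ D) x * (h2 \_ D) x)%:E)%E)//.
  by apply: integrableZl => //; exact: I.
rewrite /L2dot restrict_lin -!RintegralZl// ?(I, Z)//.
rewrite -!RintegralD// ?(I, Z)//; last first.
  by rewrite /comp; under eq_fun do rewrite EFinD; apply: integrableD => //; exact: Z.
by apply: eq_Rintegral => x _; rewrite /lin; ring.
Qed.

(** The form of the parallelogram law that measures the strict convexity of the
    squared norm at a midpoint. *)
Lemma parallelogram D f g : in_L2 m D f -> in_L2 m D g ->
  L2n D (lin 2^-1 f 2^-1 g) ^+ 2 =
  2^-1 * L2n D f ^+ 2 + 2^-1 * L2n D g ^+ 2 - 4^-1 * L2n D (f \- g) ^+ 2.
Proof. by move=> fD gD; rewrite linB !sqr_L2n_lin//; field. Qed.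

(** Minkowski's inequality; the multiples of f and g are written as degenerate
    combinations so that their norms come from the quadratic expansion. *)
Lemma L2n_lin_le D a f b g :
  in_L2 m D f -> in_L2 m D g ->
  L2n D (lin a f b g) <= `|a| * L2n D f + `|b| * L2n D g.
Proof.
move=> fD gD.
have f0 : in_L2 m D (cst 0).
  apply/in_L2P; rewrite (_ : _ \_ _ = cst 0); last first.
    by apply/funext => x; rewrite restrictE; case: ifP.
  by split => //; under eq_integral do rewrite /= expr0n/=; rewrite integral0.
have S c h : in_L2 m D h -> L2n D (lin c h 0 (cst 0)) = `|c| * L2n D h.
  move=> hD; apply/eqP; rewrite -(@eqrXn2 _ 2)// ?L2n_ge0// ?mulr_ge0 ?L2n_ge0//.
  by rewrite sqr_L2n_lin// exprMn real_normK ?num_real// expr0n/=; apply/eqP; ring.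
rewrite -!S// -lee_fin EFinD -!L2nE; try exact: in_L2_lin.
rewrite /L2norm (_ : _ \_ _ = (lin a f 0 (cst 0)) \_ D \+ (lin b g 0 (cst 0)) \_ D).
  by apply: eminkowski; rewrite ?lee1n//; apply: in_L2_measurable; exact: in_L2_lin.
by apply/funext => x; rewrite /= !restrictE /lin; case: ifP => // _; ring.
Qed.

Lemma ae_eq_L2norm D f g : measurable D -> measurable_fun D f ->
  measurable_fun D g -> ae_eq m D f g -> L2norm m D f = L2norm m D g.
Proof.
move=> mD mf mg fg; rewrite /L2norm unlock; congr (_ `^ _)%E.
transitivity (\int[m]_(x in D) (`|f x| `^ 2)%:E)%E.
  rewrite [RHS]integral_mkcond; apply: eq_integral => x _ /=.
  by rewrite !patchE; case: ifP => // _; rewrite normr0 powR0 ?pnatr_eq0.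
transitivity (\int[m]_(x in D) (`|g x| `^ 2)%:E)%E; last first.
  rewrite [LHS]integral_mkcond; apply: eq_integral => x _ /=.
  by rewrite !patchE; case: ifP => // _; rewrite normr0 powR0 ?pnatr_eq0.
have M h : measurable_fun D h -> measurable_fun D (fun x => (`|h x| `^ 2)%:E).
  move=> mh; apply/measurable_EFinP.
  apply: (@measurableT_comp _ _ _ _ _ _ (fun x : R => x `^ 2)) => //.
  exact: measurableT_comp.
apply: ae_eq_integral => //; [exact: M|exact: M|].
by apply: filterS fg => x /= fg Dx; rewrite fg.
Qed.

Lemma L2norm_eq0 D f g : in_L2 m D f -> in_L2 m D g ->
  L2norm m D (f \- g) = 0%E -> ae_eq m D f g.
Proof.
move=> fD gD fg.
have h2 : in_L2 m D (f \- g) by rewrite linB; exact: in_L2_lin.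
have := @Lnorm_eq0_eq0 _ _ _ m (EFin \o (f \- g) \_ D) 2%:E _ _ fg.
rewrite lte_fin ltr0n => /(_ _ isT) H.
have {}H := H (iffRL (measurable_EFinP _ _) (in_L2_measurable h2)).
apply: filterS H => x /= /(_ I) [] + Dx.
by rewrite restrictE mem_set// => /eqP; rewrite subr_eq0 => /eqP.
Qed.

Lemma in_L2_sub D E f : measurable D -> D `<=` E -> in_L2 m E f -> in_L2 m D f.
Proof.
move=> mD DE /in_L2P[mf foo].
have fE : f \_ D = (f \_ E) \_ D.
  apply/funext => x; rewrite !restrictE; case: ifPn => // /set_mem Dx.
  by rewrite mem_set//; exact: DE.
have mfD : measurable_fun setT (f \_ D).
  by rewrite fE; apply/(measurable_restrictT _ mD); exact: measurable_funTS.
apply/in_L2P; split => //.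
apply: le_lt_trans foo; apply: ge0_le_integral => //.
- by move=> x _; rewrite lee_fin sqr_ge0.
- by apply/measurable_EFinP; exact: measurable_funX.
- by apply/measurable_EFinP; exact: measurable_funX.
- move=> x _; rewrite lee_fin !restrictE; case: ifPn => [/set_mem Dx|_].
    by rewrite mem_set//; exact: DE.
  by rewrite expr0n/=; exact: sqr_ge0.
Qed.

Lemma le_L2n_sub D E f : measurable D -> D `<=` E -> in_L2 m E f ->
  L2n D f <= L2n E f.
Proof.
move=> mD DE fE; have fD := in_L2_sub mD DE fE.
rewrite -(@ler_pXn2r _ 2)// ?nnegrE ?L2n_ge0//.
rewrite -lee_fin !EFin_expe -!L2nE// !sqr_L2norm.
apply: ge0_le_integral => //.
- by move=> x _; rewrite lee_fin sqr_ge0.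
- by apply/measurable_EFinP; apply: measurable_funX; exact: in_L2_measurable.
- by apply/measurable_EFinP; apply: measurable_funX; exact: in_L2_measurable.
- move=> x _; rewrite lee_fin !restrictE; case: ifPn => [/set_mem Dx|_].
    by rewrite mem_set//; exact: DE.
  by rewrite expr0n/=; exact: sqr_ge0.
Qed.

End L2_calculus.

(** * Completeness of L2 *)

Section L2_complete.
Context {R : realType} {disp : measure_display} {X : measurableType disp}.
Variable m : {measure set X -> \bar R}.

Lemma limn_einf_le (u : (\bar R)^nat) (c : \bar R) (N : nat) :
  (forall n, (N <= n)%N -> (u n <= c)%E) -> (limn_einf u <= c)%E.
Proof.
move=> uc; rewrite limn_einf_lim; apply: lime_le; first exact: is_cvg_einfs.
near=> n; apply: le_trans (uc n _); last by near: n; exact: nbhs_infty_ge.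
by rewrite /einfs; apply: ereal_inf_lbound; exists n => /=.
Unshelve. all: by end_near. Qed.

Lemma sqr_L2nT f : in_L2 m setT f ->
  ((L2n m setT f ^+ 2)%:E = \int[m]_x (f x ^+ 2)%:E)%E.
Proof. by move=> fL2; rewrite EFin_expe -L2nE// sqr_L2norm patch_setT. Qed.

Let p k : R := 2^-1 ^+ k.

Let p_gt0 k : 0 < p k. Proof. by rewrite exprn_gt0. Qed.

Let sum_p n : \sum_(0 <= k < n) p k <= 2.
Proof.
suff -> : \sum_(0 <= k < n) p k = 2 - 2 * p n by rewrite gerBl mulr_ge0// ltW.
elim: n => [|n ih]; first by rewrite big_nil /p expr0; ring.
by rewrite big_nat_recr//= ih /p exprS; field.
Qed.

(** The integral of S = sum_k 2^k |f_(k+1) - f_k|^2 is at most sum_k 2^-k, so S is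
    finite almost everywhere.  Where it is, the arithmetic-geometric inequality
    |f_(k+1) - f_k| <= 2^-k + 2^k |f_(k+1) - f_k|^2 makes the telescoping series
    of the f_k absolutely convergent. *)
Lemma fast_Cauchy_ae_cvg (f : nat -> X -> R) :
  (forall n, in_L2 m setT (f n)) ->
  (forall k, L2n m setT (f k.+1 \- f k) <= 2^-1 ^+ k) ->
  exists E : set X, [/\ measurable E, m (~` E) = 0%E &
    forall x, E x -> cvgn (fun n => f n x)].
Proof.
move=> fL2 fd.
have restrT (h : X -> R) : h \_ setT = h by rewrite patch_setT.
have mf n : measurable_fun setT (f n) by rewrite -(restrT (f n)); exact: in_L2_measurable.
pose d k := f k.+1 \- f k.
have dL2 k : in_L2 m setT (d k) by rewrite /d linB; exact: in_L2_lin.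
have md k : measurable_fun setT (d k) by rewrite -(restrT (d k)); exact: in_L2_measurable.
pose u k x : \bar R := ((p k)^-1 * d k x ^+ 2)%:E.
have u0 k x : (0 <= u k x)%E by rewrite lee_fin mulr_ge0 ?sqr_ge0// invr_ge0 ltW.
have mu_ k : measurable_fun setT (u k).
  by apply/measurable_EFinP; apply: measurable_funM => //; exact: measurable_funX.
pose S x := (\sum_(0 <= k <oo) u k x)%E.
have iu k : (\int[m]_x u k x <= (p k)%:E)%E.
  rewrite /u; under eq_integral do rewrite EFinM.
  rewrite ge0_integralZl//; last 3 first.
  - by apply/measurable_EFinP; exact: measurable_funX.
  - by move=> x _; rewrite lee_fin sqr_ge0.
  - by rewrite lee_fin invr_ge0 ltW.
  rewrite -sqr_L2nT// -EFinM lee_fin ler_pdivrMl// -expr2 ler_pXn2r ?nnegrE ?L2n_ge0//.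
  - exact: fd.
  - exact: ltW.
have mS : measurable_fun setT S.
  by apply: ge0_emeasurable_sum => // k x _ _; exact: u0.
have S0 x : (0 <= S x)%E by apply: nneseries_ge0.
have iS : (\int[m]_x S x < +oo)%E.
  rewrite /S integral_nneseries//.
  apply: (@le_lt_trans _ _ 2%:E); last exact: ltry.
  apply: lime_le; first by apply: is_cvg_nneseries => k _ _; exact: integral_ge0.
  apply: nearW => n.
  apply: (@le_trans _ _ (\sum_(0 <= k < n) (p k)%:E)%E); first exact: lee_sum.
  by rewrite sumEFin lee_fin.
exists (setT `&` [set x | (S x < +oo)%E]); split.
- exact: emeasurable_fun_infty_o.
- have : m.-integrable setT S.
    by apply/integrableP; split => //; under eq_integral do rewrite gee0_abs//.
  move=> /(integrable_ae measurableT) [N [mN N0 sN]].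
  apply: (subset_measure0 _ mN _ N0).
    by apply: measurableC; exact: emeasurable_fun_infty_o.
  move=> x /= Sx; apply: sN => /= Sfin; apply: Sx; split => //.
  by have := Sfin I; rewrite ge0_fin_numE.
- move=> x [_ /= Sx].
  have cvd : cvgn (series (fun k => `|d k x|)).
    apply: (@series_le_cvg _ _ (fun k => p k + (p k)^-1 * d k x ^+ 2)).
    + by move=> k.
    + by move=> k; rewrite addr_ge0 ?(ltW (p_gt0 _))// mulr_ge0 ?sqr_ge0// invr_ge0 ltW.
    + move=> k; rewrite -[X in _ + _ * X]real_normK ?num_real//.
      set a := `|_|; have a0 : 0 <= a by exact: normr_ge0.
      rewrite -(ler_pM2l (p_gt0 k)) mulrDr mulrA mulfV ?gt_eqF// mul1r.
      by have := sqr_ge0 (p k - a); have := p_gt0 k; nra.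
    + rewrite (_ : series _ = series p + series (fun k => (p k)^-1 * d k x ^+ 2)); last first.
        by apply/funext => n; rewrite /series /= fctE big_split.
      apply: is_cvgD.
        apply: nondecreasing_is_cvgn.
          by apply: nondecreasing_series => k _ _; exact: ltW.
        by exists 2 => _ [n _ <-]; exact: sum_p.
      apply: nondecreasing_is_cvgn.
        by apply: nondecreasing_series => k _ _; rewrite mulr_ge0 ?sqr_ge0// invr_ge0 ltW.
      exists (fine (S x)) => _ [n _ <-].
      rewrite -lee_fin fineK; last by rewrite ge0_fin_numE.
      by rewrite /series /= -sumEFin; apply: nneseries_lim_ge => k _ _; exact: u0.
  have {}cvd : cvgn (series (fun k => d k x)) by exact: normed_cvg.
  rewrite (_ : (fun n => f n x) = cst (f 0%N x) + series (fun k => d k x)); last first.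
    apply/funext => n; rewrite fctE/=.
    exact: (eq_sum_telescope (fun n => f n x)).
  by apply: is_cvgD => //; exact: is_cvg_cst.
Qed.

(** Summing the moduli of continuity makes the subsequence dominate all the
    earlier ones at once. *)
Lemma fast_Cauchy_subsequence (f : nat -> X -> R) (D : set X) :
  (forall e, 0 < e -> exists N, forall i j, (N <= i)%N -> (N <= j)%N ->
    L2n m D (f i \- f j) <= e) ->
  exists s : nat -> nat, (forall n, (n <= s n)%N) /\
    forall k, L2n m D (f (s k.+1) \- f (s k)) <= 2^-1 ^+ k.
Proof.
move=> Cf.
have /choice[s sP] k := Cf (p k) (p_gt0 k).
(* the summand k is there to force k <= t k *)
pose t k := (\sum_(i < k.+1) s i + k)%N.
have ts k : (s k <= t k)%N.
  by rewrite /t big_ord_recr/=; lia.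
exists t; split => k; first by rewrite leq_addl.
apply: (sP k) => //; apply: leq_trans (ts k) _.
by rewrite /t [X in (_ <= X + _)%N]big_ord_recr/=; lia.
Qed.

(** Riesz-Fischer: a fast subsequence converges almost everywhere, and Fatou's
    lemma turns the Cauchy bound into a bound on the distance to the limit. *)
Lemma L2_complete (f : nat -> X -> R) :
  (forall n, in_L2 m setT (f n)) ->
  (forall e, 0 < e -> exists N, forall i j, (N <= i)%N -> (N <= j)%N ->
    L2n m setT (f i \- f j) <= e) ->
  exists g, in_L2 m setT g /\
    forall e, 0 < e -> exists N, forall i, (N <= i)%N ->
      L2n m setT (f i \- g) <= e.
Proof.
move=> fL2 Cf.
have restrT (h : X -> R) : h \_ setT = h by rewrite patch_setT.
have mf n : measurable_fun setT (f n) by rewrite -(restrT (f n)); exact: in_L2_measurable.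
have [s [sn sf]] := fast_Cauchy_subsequence Cf.
have [E [mE E0 cvE]] := fast_Cauchy_ae_cvg (fun n => fL2 (s n)) sf.
(* cut off outside E so that the pointwise limit exists everywhere *)
pose h n := f (s n) \_ E.
have mh n : measurable_fun setT (h n).
  by apply/(measurable_restrictT _ mE); exact: measurable_funTS.
pose g x := limn (fun n => h n x).
have hg x : h n x @[n --> \oo] --> g x.
  apply: (_ : cvgn (fun n => h n x)).
  have [Ex|nEx] := pselect (E x).
    rewrite (_ : (fun n => h n x) = fun n => f (s n) x); first exact: cvE.
    by apply/funext => n; rewrite /h restrictE mem_set.
  rewrite (_ : (fun n => h n x) = cst 0); first exact: is_cvg_cst.
  by apply/funext => n; rewrite /h restrictE memNset.
have mg : measurable_fun setT g by apply: (measurable_fun_cvg mh) => x _; exact: hg.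
have fgN e : 0 < e -> exists N, forall i, (N <= i)%N ->
    (\int[m]_x ((f i x - g x) ^+ 2)%:E <= (e ^+ 2)%:E)%E.
  move=> e0; have [N NP] := Cf e e0; exists N => i Ni.
  have mfh n : measurable_fun setT (fun x => ((f i x - h n x) ^+ 2)%:E).
    by apply/measurable_EFinP; apply: measurable_funX; exact: measurable_funB.
  have -> : (fun x => ((f i x - g x) ^+ 2)%:E) =
      fun x => limn_einf (fun n => ((f i x - h n x) ^+ 2)%:E).
    apply/funext => x; apply/esym.
    apply: (cvg_limn_einf_sup _).1; apply: cvg_EFin; first exact: nearW.
    rewrite (_ : _ \o _ = fun n => (f i x - h n x) ^+ 2)//.
    by apply: cvgM; apply: cvgB => //; exact: cvg_cst.
  apply: le_trans (fatou m measurableT mfh _) _.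
    by move=> n x _; rewrite lee_fin sqr_ge0.
  apply: (@limn_einf_le _ _ N) => n Nn.
  rewrite (ae_eq_integral (fun x => ((f i x - f (s n) x) ^+ 2)%:E))//.
  - have -> := esym (@sqr_L2nT (f i \- f (s n)) _).
      rewrite lee_fin ler_pXn2r ?nnegrE ?L2n_ge0 ?(ltW e0)//.
      by apply: NP => //; exact: leq_trans Nn (sn n).
    by rewrite linB; exact: in_L2_lin.
  - by apply/measurable_EFinP; apply: measurable_funX; exact: measurable_funB.
  - exists (~` E); split => //; first exact: measurableC.
    move=> x /= + Ex; apply => _.
    by rewrite /h restrictE mem_set.
have fgL2 : exists N, forall i, (N <= i)%N -> in_L2 m setT (f i \- g).
  have [N NP] := fgN 1 ltr01; exists N => i Ni; apply/in_L2P; rewrite restrT; split.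
    exact: measurable_funB.
  by apply: le_lt_trans (NP i Ni) _; exact: ltry.
have [N NP] := fgL2.
have gL2 : in_L2 m setT g.
  rewrite (_ : g = lin 1 (f N) (-1) (f N \- g)).
    by apply: in_L2_lin => //; exact: NP.
  by apply/funext => x; rewrite /lin /=; ring.
exists g; split => // e e0.
have [M MP] := fgN e e0; exists M => i Mi.
have fgi : in_L2 m setT (f i \- g) by rewrite linB; exact: in_L2_lin.
rewrite -(@ler_pXn2r _ 2)// ?nnegrE ?L2n_ge0 ?(ltW e0)//.
by rewrite -lee_fin sqr_L2nT//; exact: MP.
Qed.

End L2_complete.

(** * Borel sets and Lebesgue measure on row vectors *)

Lemma bounded_in_L2 {R : realType} {disp} {X : measurableType disp}
    (m : {measure set X -> \bar R}) (D : set X) (f : X -> R) (M : R) :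
  measurable D -> (m D < +oo)%E -> measurable_fun D f ->
  (forall x, D x -> `|f x| <= M) -> in_L2 m D f.
Proof.
move=> mD Doo mf fM; apply/in_L2P.
have mfD : measurable_fun setT (f \_ D) by apply/(measurable_restrictT _ mD).
split => //.
apply: (@le_lt_trans _ _ (\int[m]_(x in D) (cst (M ^+ 2)%:E x))%E).
  rewrite [leRHS]integral_mkcond; apply: ge0_le_integral => //.
  - by move=> x _; rewrite lee_fin sqr_ge0.
  - by apply/measurable_EFinP; exact: measurable_funX.
  - by apply/(measurable_restrictT _ mD); exact: measurable_cst.
  - move=> x _; rewrite restrictE patchE; case: ifPn => [/set_mem Dx|_].
      rewrite lee_fin -real_normK ?num_real// ler_pXn2r ?nnegrE//; first exact: fM.
      exact: le_trans (fM _ Dx).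
    by rewrite expr0n.
by rewrite integral_cst// lte_mul_pinfty// lee_fin sqr_ge0.
Qed.

Section row_vectors.
Context {R : realType} {n : nat}.
Implicit Types (A B : set 'rV[R]_n).

Lemma measurable_rV_forall (P : 'I_n -> set R) : (forall i, measurable (P i)) ->
  measurable [set x : 'rV[R]_n | forall i, P i (x ord0 i)].
Proof.
move=> mP.
rewrite (_ : mkset _ = \bigcap_(i in [set: 'I_n]) ((fun x : 'rV[R]_n => x ord0 i) @^-1` P i)).
  apply: fin_bigcap_measurable => // i _; rewrite -[X in measurable X]setTI.
  exact: measurable_coor.
by apply/seteqP; split=> x /= Px; [move=> i _; exact: Px|move=> i; exact: Px].
Qed.

(** The product sigma-algebra contains the topology because an open set is the
    union of the countably many rational cubes that it contains. *)
Lemma open_measurable_rV A : open A -> measurable A.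
Proof.
move=> oA.
pose box (q : {ffun 'I_n -> rat} * nat) :=
  [set x : 'rV[R]_n | forall i, (ball (ratr (q.1 i) : R) q.2.+1%:R^-1) (x ord0 i)].
pose F q := if `[< box q `<=` A >] then box q else set0.
have -> : A = \bigcup_q F q.
  apply/seteqP; split=> [x Ax|x [q _]]; last first.
    by rewrite /F; case: asboolP => // qA /qA.
  have /nbhs_ballP[e /= e0 eA] : nbhs x A by exact: open_nbhs_nbhs.
  have [k ke] : exists k, k.+1%:R^-1 < e / 2 :> R.
    have e20 : 0 < e / 2 by rewrite divr_gt0.
    have := ltr_add_invr (e20 : 0 < e / 2); move=> [k]; rewrite add0r => ?; by exists k.
  have k0 : 0 < k.+1%:R^-1 :> R by rewrite invr_gt0.
  have /choice[q qP] (i : 'I_n) : exists q : rat, ratr q \in `]x ord0 i - k.+1%:R^-1, x ord0 i + k.+1%:R^-1[.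
    by apply: rat_in_itvoo; rewrite ltrBlDr -addrA ltrDl addr_gt0.
  have qB i : `|ratr (q i) - x ord0 i| < k.+1%:R^-1.
    by have := qP i; rewrite in_itv/= ltr_norml => /andP[h1 h2]; rewrite ltrBrDr addrC h1 ltrBlDr addrC.
  exists ([ffun i => q i], k) => //; rewrite /F asboolT.
    by move=> i; rewrite /ball/= ffunE.
  move=> y By; apply: eA; split=> // i j; rewrite ord1.
  have := By j; rewrite /ball/= ffunE => Byj.
  rewrite -(subrKA (ratr (q j))); apply: le_lt_trans (ler_normD _ _) _.
  by rewrite distrC [e]splitr ltrD// ?(lt_trans (qB j) ke)// (lt_trans Byj ke).
apply: countable_bigcupT_measurable; first exact: countableP.
move=> q; rewrite /F; case: ifP => _ //.
by apply: (measurable_rV_forall (P := fun i => ball (ratr (q.1 i) : R) q.2.+1%:R^-1)) => i; exact: measurable_ball.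
Qed.

Lemma continuous_measurable_rV (f : 'rV[R]_n -> R) : continuous f ->
  measurable_fun setT f.
Proof.
move=> cf; apply: (measurability _ (RGenOInfty.measurableE R)) => _ [_ [x ->] <-].
rewrite setTI; apply: open_measurable_rV; by apply: open_comp => //; exact: interval_open.
Qed.

End row_vectors.

Definition cube (R : realType) (n : nat) (M : R) : set 'rV[R]_n :=
  [set x | forall i, (`[- M, M]%classic : set R) (x ord0 i)].

(** The Lebesgue measure on row vectors is built one coordinate at a time, and
    so is the measure of a cube. *)
Lemma leb_cube_lty {R : realType} (n : nat) (M : R) :
  (leb n (@cube R n M) < +oo)%E.
Proof.
elim: n => [|n ih].
  by rewrite /leb /= /dirac indicE; case: (_ \in _); rewrite ltry.
rewrite (_ : leb n.+1 _ = (@lebesgue_measure R \x leb n)%E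
  ((`[(- M)%R, M]%classic : set R) `*` @cube R n M)).
  rewrite product_measure1E//; last first.
    by apply: (@measurable_rV_forall R _ (fun=> `[- M, M]%classic)) => i; exact: measurable_itv.
  have cM : (@lebesgue_measure R `[(- M)%R, M]%classic < +oo)%E.
    by rewrite lebesgue_measure_itv/=; case: ifP => // _; rewrite ltry.
  by apply: lte_mul_pinfty => //; rewrite ge0_fin_numE.
rewrite /leb /= /pushforward; congr (_ _).
apply/seteqP; split=> [[a v]/= H|[a v]/= [Ha Hv] i].
  split; first by have := H ord0; rewrite rV_cons0.
  by move=> i; have := H (lift ord0 i); rewrite rV_consS.
by case: (unliftP ord0 i) => [j|] ->; rewrite ?rV_consS ?rV_cons0.
Qed.

Section polytope.
Context {R : realType} {d : nat}.
Variable Omega : set 'rV[R]_d.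
Hypothesis hOmega : convex_polytope_domain Omega.

Lemma measurable_polytope : measurable Omega.
Proof.
have [_ _ [k [a [b [_ ->]]]]] := hOmega.
rewrite [X in measurable X](_ : _ = \bigcap_(j in [set: 'I_k])
  ((fun x : 'rV[R]_d => \sum_(i < d) a j ord0 i * x ord0 i) @^-1` `]-oo, b j[)).
  apply: fin_bigcap_measurable => // j _; rewrite -[X in measurable X]setTI.
  suff : measurable_fun [set: 'rV[R]_d]
    (fun x : 'rV[R]_d => \sum_(i < d) a j ord0 i * x ord0 i) by apply.
  apply: measurable_sum => i; apply: measurable_funM => //.
  exact: measurable_coor.
by apply/seteqP; split=> x /= Px; [move=> i _|move=> i]; have := Px i;
  rewrite ?in_itv//=; apply.
Qed.

Lemma polytope_sub_cube : exists M, Omega `<=` cube M.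
Proof.
have [_ [M [Mreal MO]] _] := hOmega; exists (M + 1) => x Ox i.
have xM : `|x| <= M + 1 by apply: MO => //; rewrite ltrDl.
rewrite /mkset /= in_itv/= -ler_norml.
apply: le_trans xM; rewrite [leRHS]/Num.Def.normr/= mx_normrE.
by apply/bigmax_geP; right => /=; exists (ord0, i).
Qed.

Lemma leb_polytope_lty : (leb d Omega < +oo)%E.
Proof.
have [M OM] := polytope_sub_cube.
apply: le_lt_trans (leb_cube_lty d M).
apply: le_measure; rewrite ?inE//.
- exact: measurable_polytope.
- by apply: (@measurable_rV_forall R _ (fun=> `[- M, M]%classic)) => i; exact: measurable_itv.
Qed.

(** Omega lies in a cube, which is compact and has finite measure. *)
Lemma continuous_in_L2 (f : 'rV[R]_d -> R) : continuous f ->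
  in_L2 (leb d) Omega f.
Proof.
move=> cf; have [M OM] := polytope_sub_cube.
have cK : compact (@cube R d M).
  by apply: (rV_compact (A := fun=> `[- M, M]%classic)) => i; exact: segment_compact.
have [N [_ NP]] : bounded_set (f @` @cube R d M).
  by apply: compact_bounded; apply: continuous_compact => //; exact: continuous_subspaceT.
apply: (@bounded_in_L2 _ _ _ _ _ _ (N + 1)).
- exact: measurable_polytope.
- exact: leb_polytope_lty.
- by apply: measurable_funTS; exact: continuous_measurable_rV.
- by move=> x /OM Ox; apply: NP; [rewrite ltrDl|exists x].
Qed.

Lemma smooth_in_L2 (phi : 'rV[R]_d -> R) : smooth phi ->
  in_L2 (leb d) Omega phi /\ forall i, in_L2 (leb d) Omega (pderiv i phi).
Proof.
move=> sphi; split=> [|i]; apply: continuous_in_L2 => x;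
  apply: differentiable_continuous.
  exact: (sphi [::]).
exact: (sphi [:: i]).
Qed.

End polytope.

Lemma interval_continuous_in_L2 {R : realType} (T : R) (f : R -> R) :
  continuous f -> in_L2 (@lebesgue_measure R) `]0, T[ f.
Proof.
move=> cf.
have [N [_ NP]] : bounded_set (f @` `[0, T]).
  apply: compact_bounded; apply: continuous_compact; last exact: segment_compact.
  exact: continuous_subspaceT.
apply: (@bounded_in_L2 _ _ _ _ _ _ (N + 1)).
- exact: measurable_itv.
- by rewrite /= lebesgue_measure_itv/=; case: ifP => // _; rewrite ltry.
- by apply: measurable_funTS; exact: continuous_measurable_fun.
- move=> x Ox; apply: NP; [by rewrite ltrDl|exists x => //].
  by move: Ox; rewrite /= !in_itv/= => /andP[/ltW-> /ltW->].
Qed.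

Lemma time_test_function_in_L2 {R : realType} (T : R) (psi : R -> R) :
  time_test_function T psi ->
  in_L2 (@lebesgue_measure R) `]0, T[ psi /\
  in_L2 (@lebesgue_measure R) `]0, T[ (derive1 psi).
Proof.
move=> [dpsi _]; split; apply: interval_continuous_in_L2 => t;
  apply: differentiable_continuous; apply/derivable1_diffP.
  exact: (dpsi 0%N).
exact: (dpsi 1%N).
Qed.

(** * Linearity of the fractional Sobolev conditions *)

Section halpha_linear.
Context {R : realType} {d : nat}.
Variables (Omega : set 'rV[R]_d) (T : R).
Hypothesis mO : measurable Omega.
Notation Qtype := ('rV[R]_d * measurableTypeR R)%type.
Notation Q := (cylinder T Omega).
Notation I := (`]0, T[%classic : set R).
Implicit Types (u v : Qtype -> R) (a b t s alpha : R).

Lemma measurable_cylinder : measurable (Q : set Qtype).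
Proof. by apply: measurableX => //; exact: measurable_itv. Qed.

(** The sections at times in (0,T) only see the restriction of u to the
    cylinder, the part that is known to be measurable. *)
Lemma restrict_slice u t : I t ->
  (slice u t) \_ Omega = fun x => (u \_ Q) (x, t).
Proof.
move=> It; apply/funext => x; rewrite !restrictE /slice.
have [Ox|nOx] := pselect (Omega x); first by rewrite !mem_set.
by rewrite !memNset// => -[].
Qed.

Lemma measurable_slice u t : measurable_fun setT (u \_ Q) -> I t ->
  measurable_fun setT ((slice u t) \_ Omega).
Proof.
move=> mu It; rewrite restrict_slice//.
exact: (measurableT_comp mu (pair2_measurable (t : measurableTypeR R))).
Qed.

Lemma slice_lin a u b v t : slice (lin a u b v) t = lin a (slice u t) b (slice v t).
Proof. by []. Qed.

Lemma slice_linB a u b v t s : slice (lin a u b v) t \- slice (lin a u b v) s =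
  lin a (slice u t \- slice u s) b (slice v t \- slice v s).
Proof. by apply/funext => x; rewrite /lin /slice /=; ring. Qed.

(** The integrand of the Sobolev-Slobodeckij seminorm, extended by 0 so that the
    seminorm is a single integral over the plane. *)
Definition gagliardo alpha u (z : measurableTypeR R * measurableTypeR R) : \bar R :=
  ((fun z => L2norm (leb d) Omega (slice u z.1 \- slice u z.2)%R ^+ 2 *
     (`|z.1 - z.2| `^ (- (1 + 2 * alpha)))%:E) \_ (I `*` I) z)%E.

Lemma gagliardo_ge0 alpha u z : (0 <= gagliardo alpha u z)%E.
Proof.
rewrite /gagliardo patchE; case: ifP => // _.
by apply: mule_ge0; rewrite ?lee_fin ?powR_ge0//; exact: sqr_L2norm_ge0.
Qed.

(** The squared distance between two time slices is an integral over Omega of a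
    jointly measurable function, hence measurable in both times by Tonelli. *)
Lemma measurable_gagliardo alpha u : measurable_fun setT (u \_ Q) ->
  measurable_fun setT (gagliardo alpha u).
Proof.
move=> mu.
pose F (z : (measurableTypeR R * measurableTypeR R) * 'rV[R]_d) : \bar R :=
  (((u \_ Q) (z.2, z.1.1) - (u \_ Q) (z.2, z.1.2)) ^+ 2)%:E.
have mF : measurable_fun setT F.
  apply/measurable_EFinP; apply: measurable_funX; apply: measurable_funB.
    apply: (measurableT_comp mu); apply/measurable_fun_pairP; split => /=.
      exact: measurable_snd.
    exact: (measurableT_comp measurable_fst measurable_fst).
  apply: (measurableT_comp mu); apply/measurable_fun_pairP; split => /=.
    exact: measurable_snd.
  exact: (measurableT_comp measurable_snd measurable_fst).
have F0 z : (0 <= F z)%E by rewrite lee_fin sqr_ge0.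
have mG := @measurable_fun_fubini_tonelli_F _ _ _ _ _ (leb d) F mF F0.
rewrite /gagliardo.
have mII : measurable (I `*` I) by apply: measurableX; exact: measurable_itv.
apply/(measurable_restrictT _ mII).
apply: (@eq_measurable_fun _ _ _ _ _ (fun z => fubini_F (leb d) F z *
  (`|z.1 - z.2| `^ (- (1 + 2 * alpha)))%:E)%E).
  move=> z /set_mem [I1 I2]; rewrite sqr_L2norm; congr (_ * _)%E.
  rewrite /fubini_F; apply: eq_integral => x _; rewrite /F /=.
  by rewrite linB restrict_lin !restrict_slice// /lin mul1r mulN1r.
apply: measurable_funTS; apply: emeasurable_funM => //.
apply/measurable_EFinP; apply: (measurableT_comp (measurable_powR _)).
by apply: measurableT_comp => //; apply: measurable_funB.
Qed.

Lemma Halpha_seminorm2E alpha u : measurable_fun setT (u \_ Q) ->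
  (Halpha_seminorm2 Omega T alpha u =
   \int[@lebesgue_measure R \x @lebesgue_measure R]_z gagliardo alpha u z)%E.
Proof.
move=> mu; rewrite fubini_tonelli1; last 2 first.
- exact: measurable_gagliardo.
- exact: gagliardo_ge0.
rewrite /Halpha_seminorm2 integral_mkcond; apply: eq_integral => t _.
rewrite /fubini_F patchE; case: ifPn => [/set_mem It|/negP nIt].
  transitivity (\int[@lebesgue_measure R]_s gagliardo alpha u (t, s))%E; last by [].
  rewrite integral_mkcond; apply: eq_integral => s _.
  rewrite /gagliardo !patchE; case: ifPn => [/set_mem Is|nIs].
    by rewrite mem_set.
  by rewrite memNset// => -[_ /= Is]; move/negP: nIs; apply; exact/mem_set.
rewrite integral0_eq// => s _.
by rewrite /gagliardo patchE memNset// => -[/= It _]; apply: nIt; exact/mem_set.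
Qed.

Lemma Halpha_lin alpha a u b v : in_Halpha Omega T alpha u ->
  in_Halpha Omega T alpha v -> in_Halpha Omega T alpha (lin a u b v).
Proof.
move=> [u2 us] [v2 vs]; split; first exact: in_L2_lin.
have mu := in_L2_measurable u2; have mv := in_L2_measurable v2.
have muv : measurable_fun setT ((lin a u b v) \_ Q).
  exact: (in_L2_measurable (in_L2_lin a b u2 v2)).
rewrite Halpha_seminorm2E//.
move: us vs; rewrite !Halpha_seminorm2E// => us vs.
apply: (lin_integral_lty (a := 2 * a ^+ 2) (b := 2 * b ^+ 2)
  _ _ (gagliardo_ge0 alpha u) (gagliardo_ge0 alpha v) (gagliardo_ge0 _ _)
  (measurable_gagliardo alpha mu) (measurable_gagliardo alpha mv)
  (measurable_gagliardo alpha muv) _ us vs).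
- by rewrite mulr_ge0 ?sqr_ge0.
- by rewrite mulr_ge0 ?sqr_ge0.
- move=> z; rewrite /gagliardo !patchE; case: ifPn => [/set_mem[I1 I2]|_]; last first.
    by rewrite !mule0 adde0.
  apply: lee_lin_mulr;
    [by rewrite mulr_ge0 ?sqr_ge0|by rewrite mulr_ge0 ?sqr_ge0
    |exact: sqr_L2norm_ge0|exact: sqr_L2norm_ge0|by rewrite lee_fin powR_ge0|].
  rewrite slice_linB; apply: sqr_L2norm_lin_le; rewrite linB restrict_lin;
    by apply: measurable_lin; exact: measurable_slice.
Qed.

(** The integrand of the condition at time 0 in the critical case alpha = 1/2,
    extended by 0. *)
Definition hardy u (t : measurableTypeR R) : \bar R :=
  ((fun t => L2norm (leb d) Omega (slice u t) ^+ 2 * (t^-1)%:E) \_ I t)%E.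

Lemma hardy_ge0 u t : (0 <= hardy u t)%E.
Proof.
rewrite /hardy patchE; case: ifPn => // /set_mem; rewrite /= in_itv/= => /andP[t0 _].
apply: mule_ge0; first exact: sqr_L2norm_ge0.
by rewrite lee_fin invr_ge0 ltW.
Qed.

Lemma measurable_hardy u : measurable_fun setT (u \_ Q) ->
  measurable_fun setT (hardy u).
Proof.
move=> mu.
pose F (z : measurableTypeR R * 'rV[R]_d) : \bar R := (((u \_ Q) (z.2, z.1)) ^+ 2)%:E.
have mF : measurable_fun setT F.
  apply/measurable_EFinP; apply: measurable_funX; apply: (measurableT_comp mu).
  by apply/measurable_fun_pairP; split => /=; [exact: measurable_snd|exact: measurable_fst].
have F0 z : (0 <= F z)%E by rewrite lee_fin sqr_ge0.
have mG := @measurable_fun_fubini_tonelli_F _ _ _ _ _ (leb d) F mF F0.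
have mI : measurable I by exact: measurable_itv.
apply/(measurable_restrictT _ mI).
apply: (@eq_measurable_fun _ _ _ _ _ (fun t => fubini_F (leb d) F t * (t `^ -1)%:E)%E).
  move=> t /set_mem It; rewrite sqr_L2norm powR_inv1; last first.
    by move: It; rewrite /= in_itv/= => /andP[/ltW].
  congr (_ * _)%E; rewrite /fubini_F; apply: eq_integral => x _; rewrite /F /=.
  by rewrite !restrict_slice.
apply: measurable_funTS; apply: emeasurable_funM => //.
by apply/measurable_EFinP; exact: measurable_powR.
Qed.

Lemma hardyE u :
  (\int[lebesgue_measure]_(t in `]0%R, T[)
    (L2norm (leb d) Omega (slice u t) ^+ 2 * (t^-1)%:E) =
   \int[@lebesgue_measure R]_t hardy u t)%E.
Proof. by rewrite integral_mkcond. Qed.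

Lemma C_L2_lin a u b v : in_C_L2 Omega T u -> in_C_L2 Omega T v ->
  in_C_L2 Omega T (lin a u b v).
Proof.
move=> [u2 uc] [v2 vc]; split => [t It|t It].
  by rewrite slice_lin; apply: in_L2_lin; [exact: u2|exact: v2].
have sB w s : (forall r, r \in `[0, T] -> in_L2 (leb d) Omega (slice w r)) ->
    s \in `[0, T] -> in_L2 (leb d) Omega (slice w s \- slice w t).
  by move=> w2 Is; rewrite linB; apply: in_L2_lin; exact: w2.
apply: (@squeeze_cvge _ _ _ _ (cst 0%E) _ (fun s =>
  `|a|%:E * L2norm (leb d) Omega (slice u s \- slice u t)%R +
  `|b|%:E * L2norm (leb d) Omega (slice v s \- slice v t)%R)%E).
- near=> s; rewrite L2norm_ge0/=.
  have Is : s \in `[0, T] by near: s; exact: withinT.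
  rewrite slice_linB L2nE; last by apply: in_L2_lin; exact: sB.
  by rewrite !L2nE; [rewrite -!EFinM -EFinD lee_fin; apply: L2n_lin_le; exact: sB|exact: sB|exact: sB].
- exact: cvg_cst.
- rewrite -[0%E](_ : `|a|%:E * 0 + `|b|%:E * 0 = 0)%E; last by rewrite !mule0 adde0.
  apply: cvgeD; first by rewrite !mule0.
    by apply: cvgeZl => //; exact: uc.
  by apply: cvgeZl => //; exact: vc.
Unshelve. all: by end_near. Qed.

Lemma zero_Halpha_lin alpha a u b v : in_0Halpha Omega T alpha u ->
  in_0Halpha Omega T alpha v -> in_0Halpha Omega T alpha (lin a u b v).
Proof.
move=> [uH uh u0] [vH vh v0]; split; first exact: Halpha_lin.
- move=> ha; have {}uh := uh ha; have {}vh := vh ha.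
  have mu := in_L2_measurable uH.1; have mv := in_L2_measurable vH.1.
  have mw : measurable_fun setT ((lin a u b v) \_ Q).
    exact: (in_L2_measurable (in_L2_lin a b uH.1 vH.1)).
  move: uh vh; rewrite !hardyE => uh vh.
  suff : (\int[@lebesgue_measure R]_t hardy (lin a u b v) t < +oo)%E by rewrite -hardyE.
  apply: (lin_integral_lty (m := lebesgue_measure) (a := 2 * a ^+ 2) (b := 2 * b ^+ 2)
    _ _ (hardy_ge0 u) (hardy_ge0 v) (hardy_ge0 _) (measurable_hardy mu)
    (measurable_hardy mv) (measurable_hardy mw) _ uh vh).
  + by rewrite mulr_ge0 ?sqr_ge0.
  + by rewrite mulr_ge0 ?sqr_ge0.
  + move=> t; rewrite /hardy !patchE; case: ifPn => [/set_mem It|_]; last first.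
      by rewrite !mule0 adde0.
    apply: lee_lin_mulr;
      [by rewrite mulr_ge0 ?sqr_ge0|by rewrite mulr_ge0 ?sqr_ge0
      |exact: sqr_L2norm_ge0|exact: sqr_L2norm_ge0| |].
      by move: It; rewrite /= in_itv/= lee_fin invr_ge0 => /andP[/ltW].
    by rewrite slice_lin; apply: sqr_L2norm_lin_le; exact: measurable_slice.
- move=> ha; have [u' [u'C uu' u'0]] := u0 ha; have [v' [v'C vv' v'0]] := v0 ha.
  exists (lin a u' b v'); split; first exact: C_L2_lin.
  + by apply: filterS2 uu' vv' => z /= uz vz Qz; rewrite /lin uz// vz.
  + apply: filterS2 u'0 v'0 => x /= ux vx Ox; have := ux Ox; have := vx Ox.
    by rewrite /slice /lin => -> ->; rewrite !mulr0 addr0.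
Qed.

End halpha_linear.

(** * Linearity of weak derivatives *)

(** filterS2 for the conull sets of a measure that can be named, as unification
    does not always recover the filter. *)
Lemma ae_imply2 {R : realType} {disp : measure_display} {X : measurableType disp}
    (m : {measure set X -> \bar R}) (P Q S : X -> Prop) :
  (forall x, P x -> Q x -> S x) ->
  {ae m, forall x, P x} -> {ae m, forall x, Q x} -> {ae m, forall x, S x}.
Proof. by move=> PQS; apply: filterS2. Qed.

Section Rintegral_linear.
Context {R : realType} {disp : measure_display} {X : measurableType disp}.
Variables (m : {measure set X -> \bar R}) (D : set X).
Hypothesis mD : measurable D.
Implicit Types (f g h : X -> R) (a b : R).

Lemma integrable_lin a f b g : m.-integrable D (EFin \o f) ->
  m.-integrable D (EFin \o g) -> m.-integrable D (EFin \o lin a f b g).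
Proof.
move=> fi gi.
have -> : EFin \o lin a f b g =
    ((fun x => a%:E * (f x)%:E) \+ (fun x => b%:E * (g x)%:E))%E.
  by apply/funext => x; rewrite /lin /= EFinD !EFinM.
by apply: integrableD => //; apply: integrableZl.
Qed.

Lemma Rintegral_lin a f b g : m.-integrable D (EFin \o f) ->
  m.-integrable D (EFin \o g) ->
  \int[m]_(x in D) lin a f b g x =
  a * \int[m]_(x in D) f x + b * \int[m]_(x in D) g x.
Proof.
move=> fi gi; rewrite -!RintegralZl//.
have Z c h : m.-integrable D (EFin \o h) ->
    m.-integrable D (EFin \o (fun x => c * h x)).
  move=> hi; rewrite (_ : _ \o _ = fun x => (c%:E * (h x)%:E)%E)//.
  exact: integrableZl.
by rewrite -RintegralD//; exact: Z.
Qed.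

Lemma Rintegral_lin_mul a f b g h : in_L2 m D f -> in_L2 m D g -> in_L2 m D h ->
  \int[m]_(x in D) (lin a f b g x * h x) =
  a * \int[m]_(x in D) (f x * h x) + b * \int[m]_(x in D) (g x * h x).
Proof.
move=> fD gD hD; rewrite -Rintegral_lin; try exact: integrable_mul.
by apply: eq_Rintegral => x _; rewrite /lin; ring.
Qed.

End Rintegral_linear.

Section product_ae.
Context {R : realType} {d1 d2 : measure_display} {X : measurableType d1}
  {Y : measurableType d2}.
Variables (m1 : {sigma_finite_measure set X -> \bar R})
  (m2 : {sigma_finite_measure set Y -> \bar R}).

(** Almost every section of a null set of a product is null. *)
Lemma ae_product (P : X * Y -> Prop) :
  {ae (m1 \x m2)%E, forall z, P z} ->
  {ae m1, forall x, {ae m2, forall y, P (x, y)}}.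
Proof.
move=> [N [mN N0 sN]].
have mS : measurable_fun setT (m2 \o xsection N) by exact: measurable_fun_xsection.
have : (\int[m1]_x `|(m2 \o xsection N) x| = 0)%E.
  rewrite -N0; apply: eq_integral => x _ /=; rewrite gee0_abs//.
move/(ae_eq_integral_abs m1 measurableT mS).
apply: filterS => x /= /(_ I) Nx0.
exists (xsection N x); split => //; first exact: measurable_xsection.
by move=> y /= nP; rewrite /xsection /= inE; exact: sN.
Qed.

End product_ae.

Section weak_derivatives_linear.
Context {R : realType} {d : nat}.
Variables (Omega : set 'rV[R]_d) (T : R).
Hypothesis hO : convex_polytope_domain Omega.
Notation Qtype := ('rV[R]_d * measurableTypeR R)%type.
Notation Q := (cylinder T Omega).
Notation I := (`]0, T[%classic : set R).
Implicit Types (u v w : Qtype -> R) (a b t s alpha : R).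

Let mO : measurable Omega. Proof. exact: measurable_polytope. Qed.
Let mQ : measurable (Q : set Qtype). Proof. exact: measurable_cylinder. Qed.

Lemma weak_pderiv_lin i a (f g f' g' : 'rV[R]_d -> R) b :
  weak_pderiv Omega i f g -> weak_pderiv Omega i f' g' ->
  weak_pderiv Omega i (lin a f b f') (lin a g b g').
Proof.
move=> [f2 g2 fg] [f'2 g'2 f'g']; split; try exact: in_L2_lin.
move=> phi tphi; have [sphi _] := tphi; have [phi2 dphi2] := smooth_in_L2 hO sphi.
by rewrite !Rintegral_lin_mul// fg// f'g'// !mulrN opprD.
Qed.

Lemma weak_dx_lin i a u b v g h : weak_dx Omega T i u g -> weak_dx Omega T i v h ->
  weak_dx Omega T i (lin a u b v) (lin a g b h).
Proof.
move=> [u2 g2 ug] [v2 h2 vh]; split; try exact: in_L2_lin.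
apply: (ae_imply2 (m := lebesgue_measure) _ ug vh) => t {}ug {}vh It.
by rewrite !slice_lin; apply: weak_pderiv_lin; [exact: ug|exact: vh].
Qed.

Lemma L2H1_lin a u b v g h : L2H1_grad Omega T u g -> L2H1_grad Omega T v h ->
  L2H1_grad Omega T (lin a u b v) (fun i => lin a (g i) b (h i)).
Proof.
move=> [u2 ug] [v2 vh]; split; first exact: in_L2_lin.
by move=> i; exact: weak_dx_lin.
Qed.

Lemma L2H2_lin a u b v g h G H : L2H2_hess Omega T u g G ->
  L2H2_hess Omega T v h H ->
  L2H2_hess Omega T (lin a u b v) (fun i => lin a (g i) b (h i))
    (fun i j => lin a (G i j) b (H i j)).
Proof.
move=> [ug gG] [vh hH]; split; first exact: L2H1_lin.
by move=> i; exact: L2H1_lin.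
Qed.

Lemma ae_section_in_L2 u : in_L2 leb_xt Q u ->
  {ae leb d, forall x, Omega x ->
    in_L2 (@lebesgue_measure R) I (fun t => u (x, t))}.
Proof.
move=> /in_L2P[mu uoo].
pose F (z : Qtype) : \bar R := (((u \_ Q) z) ^+ 2)%:E.
have iF : (leb d \x @lebesgue_measure R)%E.-integrable setT F.
  apply/integrableP; split; first by apply/measurable_EFinP; exact: measurable_funX.
  by under eq_integral do rewrite gee0_abs ?lee_fin ?sqr_ge0//.
have := ae_integrable1 iF.
apply: filterS => x /integrableP[_ xoo] Ox.
have E : (fun t => u (x, t)) \_ I = fun t => (u \_ Q) (x, t).
  apply/funext => t; rewrite !restrictE.
  have [It|nIt] := pselect (I t); first by rewrite !mem_set.
  by rewrite !memNset// => -[].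
apply/in_L2P; rewrite E; split.
  exact: (measurableT_comp mu (pair1_measurable x)).
apply: le_lt_trans xoo; rewrite le_eqVlt; apply/orP; left; apply/eqP.
by apply: eq_integral => t _; rewrite gee0_abs// lee_fin sqr_ge0.
Qed.

Lemma weak_dt_lin a u b v u' v' : weak_dt Omega T u u' -> weak_dt Omega T v v' ->
  weak_dt Omega T (lin a u b v) (lin a u' b v').
Proof.
move=> [u2 u'2 uu'] [v2 v'2 vv']; split; try exact: in_L2_lin.
move=> psi tpsi; have [psi2 dpsi2] := time_test_function_in_L2 tpsi.
have uv2 := ae_imply2 (fun x => @conj _ _) (ae_section_in_L2 u2) (ae_section_in_L2 v2).
have uv'2 := ae_imply2 (fun x => @conj _ _) (ae_section_in_L2 u'2) (ae_section_in_L2 v'2).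
have uv := ae_imply2 (fun x => @conj _ _) (uu' _ tpsi) (vv' _ tpsi).
have L2 := ae_imply2 (fun x => @conj _ _) uv2 uv'2.
apply: ae_imply2 L2 uv => x [[ux vx] [u'x v'x]] [eu ev] Ox.
have {}ux := ux Ox; have {}vx := vx Ox; have {}u'x := u'x Ox; have {}v'x := v'x Ox.
have mI : measurable (I : set (measurableTypeR R)) by exact: measurable_itv.
have := Rintegral_lin_mul mI a b ux vx dpsi2.
have := Rintegral_lin_mul mI a b u'x v'x psi2.
by rewrite /lin eu// ev// => -> ->; rewrite !mulrN opprD.
Qed.

(** The weak time derivative tests a function against each fixed x, so a null set
    of the cylinder has to be cut into null sections first. *)
Lemma weak_dt_ae_eq v v' w : weak_dt Omega T v w -> in_L2 leb_xt Q v' ->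
  ae_eq leb_xt Q v v' -> weak_dt Omega T v' w.
Proof.
move=> [v2 w2 vw] v'2 vv'; split => // psi tpsi.
have [psi2 dpsi2] := time_test_function_in_L2 tpsi.
have vv'x := @ae_product _ _ _ _ _ (leb d) (@lebesgue_measure R) _ vv'.
have L2 := ae_imply2 (fun x => @conj _ _) (ae_section_in_L2 v2) (ae_section_in_L2 v'2).
have H := ae_imply2 (fun x => @conj _ _) L2 vv'x.
apply: ae_imply2 H (vw _ tpsi) => x [[vx v'x] ex] ew Ox.
rewrite -ew//; have {}vx := vx Ox; have {}v'x := v'x Ox.
have mI : measurable (I : set (measurableTypeR R)) by exact: measurable_itv.
congr fine; apply: ae_eq_integral => //.
- exact: (measurable_int _ (integrable_mul mI v'x dpsi2)).
- exact: (measurable_int _ (integrable_mul mI vx dpsi2)).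
- by apply: filterS ex => t /= et It; rewrite et.
Qed.

End weak_derivatives_linear.

(** * Linearity of the fractional problem *)

Section solution_linear.
Context {R : realType} {d : nat}.
Variables (Omega : set 'rV[R]_d) (T : R).
Hypothesis hO : convex_polytope_domain Omega.
Notation Qtype := ('rV[R]_d * measurableTypeR R)%type.
Notation Q := (cylinder T Omega).
Notation I := (`]0, T[%classic : set R).
Implicit Types (u v w : Qtype -> R) (a b t s alpha : R).

Let mO : measurable Omega. Proof. exact: measurable_polytope. Qed.
Let mQ : measurable (Q : set Qtype). Proof. exact: measurable_cylinder. Qed.

Definition frac_integral alpha u (z : Qtype) : R :=
  RL_integral (1 - alpha) (fun s => u (z.1, s)) z.2.

Definition frac_kernel alpha u (z : Qtype) (s : measurableTypeR R) : R :=
  u (z.1, s) / (z.2 - s) `^ alpha.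

Lemma frac_integralE alpha u z : frac_integral alpha u z =
  (Gamma (1 - alpha))^-1 *
  \int[@lebesgue_measure R]_(s in `]0, z.2[) frac_kernel alpha u z s.
Proof. by rewrite /frac_integral /RL_integral subKr. Qed.

(** The positive and negative parts of the integrand are jointly measurable on
    the triangle 0 < s < t, so Tonelli gives the measurability of both integrals
    everywhere, including where their difference is not a convergent
    integral. *)
Lemma measurable_frac_integral alpha u : measurable_fun setT (u \_ Q) ->
  measurable_fun setT ((frac_integral alpha u) \_ Q).
Proof.
move=> mu.
(* the extra coordinate z.2 is the integration variable s *)
pose S := [set z : Qtype * measurableTypeR R | 0 < z.2 < z.1.2].
have mS : measurable S.
  rewrite (_ : S = (fun z => (0 < z.2) && (z.2 < z.1.2)) @^-1` [set true]); last first.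
    by apply/seteqP; split=> z.
  rewrite -[X in measurable X]setTI.
  have m2 : measurable_fun setT (fun z : Qtype * measurableTypeR R => z.1.2).
    exact: (measurableT_comp measurable_snd measurable_fst).
  suff : measurable_fun setT (fun z : Qtype * measurableTypeR R =>
    (0 < z.2) && (z.2 < z.1.2)) by apply.
  by apply: measurable_and; apply: measurable_fun_ltr => //; exact: measurable_snd.
pose F (z : Qtype * measurableTypeR R) : \bar R :=
  (((fun z => (u \_ Q) (z.1.1, z.2) / (z.1.2 - z.2) `^ alpha) \_ S) z)%:E.
have mF : measurable_fun setT F.
  apply/measurable_EFinP; apply/(measurable_restrictT _ mS).
  apply: measurable_funTS.
  have m2 : measurable_fun setT (fun z : Qtype * measurableTypeR R => z.1.2).
    exact: (measurableT_comp measurable_snd measurable_fst).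
  have m1 : measurable_fun setT (fun z : Qtype * measurableTypeR R => z.1.1).
    exact: (measurableT_comp measurable_fst measurable_fst).
  apply: measurable_funM.
    apply: (measurableT_comp mu); apply/measurable_fun_pairP; split; [exact: m1|exact: measurable_snd].
  apply: (@eq_measurable_fun _ _ _ _ _ (fun z : Qtype * measurableTypeR R =>
    (z.1.2 - z.2) `^ (- alpha))); first by move=> z _; rewrite powRN.
  apply: (measurableT_comp (measurable_powR _)).
  by apply: measurable_funB.
have mG : measurable_fun setT (fun z => \int[@lebesgue_measure R]_s F (z, s))%E.
  have mp := @measurable_fun_fubini_tonelli_F _ _ _ _ _ (@lebesgue_measure R)
    (F^\+)%E (measurable_funepos mF) (fun=> funepos_ge0 _ _).
  have mn := @measurable_fun_fubini_tonelli_F _ _ _ _ _ (@lebesgue_measure R)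
    (F^\-)%E (measurable_funeneg mF) (fun=> funeneg_ge0 _ _).
  apply: (eq_measurable_fun _ _ (emeasurable_funB mp mn)) => z _.
  rewrite /fubini_F [RHS]integralE.
  by congr (_ - _)%E; apply: eq_integral => s _; rewrite ?funeposE ?funenegE.
have mfG : measurable_fun setT (fun z => fine (\int[@lebesgue_measure R]_s F (z, s))%E).
  by apply: measurableT_comp => //; exact: fine_measurable.
apply/(measurable_restrictT _ mQ).
apply: (@eq_measurable_fun _ _ _ _ _ (fun z => (Gamma (1 - alpha))^-1 *
  fine (\int[@lebesgue_measure R]_s F (z, s))%E)).
  move=> z /set_mem [Oz Iz]; rewrite frac_integralE; congr (_ * fine _).
  rewrite [RHS]integral_mkcond; apply: eq_integral => s _.
  rewrite /F [in LHS]patchE [in RHS]patchE /frac_kernel.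
  have [Is|nIs] := pselect (`]0, z.2[%classic s); last first.
    by rewrite !memNset// => H; apply: nIs; rewrite /= in_itv/=; exact: H.
  have S1 : S (z, s) by move: Is; rewrite /= in_itv.
  rewrite !mem_set//= restrictE mem_set//; split => //=.
  move: Is Iz; rewrite /= !in_itv/= => /andP[-> sz] /andP[_ zT].
  exact: lt_trans zT.
by apply: measurable_funTS; apply: measurable_funM.
Qed.

(** Convergence of both integrals is essential here: divergent integrals are
    assigned conventional values that do not add up. *)
Lemma frac_integral_lin alpha a u b v z :
  (@lebesgue_measure R).-integrable `]0, z.2[ (EFin \o frac_kernel alpha u z) ->
  (@lebesgue_measure R).-integrable `]0, z.2[ (EFin \o frac_kernel alpha v z) ->
  frac_integral alpha (lin a u b v) z =
  lin a (frac_integral alpha u) b (frac_integral alpha v) z.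
Proof.
move=> ui vi; rewrite /lin !frac_integralE.
transitivity ((Gamma (1 - alpha))^-1 * \int[@lebesgue_measure R]_(s in `]0, z.2[)
  lin a (frac_kernel alpha u z) b (frac_kernel alpha v z) s).
  by congr (_ * _); apply: eq_Rintegral => s _; rewrite /frac_kernel /lin; ring.
by rewrite Rintegral_lin//; ring.
Qed.

(** Measurability of v cannot be deduced from that of u, as the product
    sigma-algebra is not complete. *)
Lemma in_L2_ae_eq u v : in_L2 leb_xt Q u -> measurable_fun setT (v \_ Q) ->
  ae_eq leb_xt Q u v -> in_L2 leb_xt Q v.
Proof.
move=> u2 mv uv; have mu := in_L2_measurable u2.
have E := ae_eq_L2norm mQ (iffRL (measurable_restrictT _ mQ) mu)
  (iffRL (measurable_restrictT _ mQ) mv) uv.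
apply/in_L2P; split => //; rewrite -sqr_L2norm -E.
by move/in_L2P : u2 => [_]; rewrite sqr_L2norm.
Qed.

Lemma caputo_lin alpha a u b v u' v' :
  in_L2 leb_xt Q u -> in_L2 leb_xt Q v ->
  caputo Omega T alpha u u' -> caputo Omega T alpha v v' ->
  caputo Omega T alpha (lin a u b v) (lin a u' b v').
Proof.
move=> u2 v2 [iu wu] [iv wv].
have mI (t : R) : measurable (`]0, t[%classic : set (measurableTypeR R)).
  exact: measurable_itv.
split.
  apply: ae_imply2 iu iv => z iu iv Qz.
  have := integrable_lin (mI z.2) a b (iu Qz) (iv Qz).
  by apply: eq_integrable => // s _; rewrite /lin /=; congr EFin; ring.
apply: (weak_dt_ae_eq (v := lin a (frac_integral alpha u) b (frac_integral alpha v))).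
- exact: weak_dt_lin.
- apply: (in_L2_ae_eq (u := lin a (frac_integral alpha u) b (frac_integral alpha v))).
  + by apply: in_L2_lin; [case: wu|case: wv].
  + apply: (measurable_frac_integral alpha (u := lin a u b v)).
    exact: (in_L2_measurable (in_L2_lin a b u2 v2)).
  + apply: ae_imply2 iu iv => z iu iv Qz.
    by rewrite -frac_integral_lin//; [exact: iu|exact: iv].
- apply: ae_imply2 iu iv => z iu iv Qz.
  by rewrite -frac_integral_lin//; [exact: iu|exact: iv].
Qed.

Lemma essentially_bounded_in_L2 (mu : R -> R) :
  in_Lp (@lebesgue_measure R) +oo%E I mu -> in_L2 (@lebesgue_measure R) I mu.
Proof.
move=> /andP[/[!inE] mmu].
rewrite /= /finite_norm unlock /= ifT; last first.
  apply: (@lt_le_trans _ _ (@lebesgue_measure R `[0%R, 1%R]%classic)).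
    by rewrite lebesgue_measure_itv/= lte_fin ltr01 oppr0 adde0 lte_fin ltr01.
  by apply: le_measure; rewrite ?inE//; exact: measurable_itv.
move=> /ess_supr_bounded[M fM]; apply/in_L2P; split => //.
have mI : measurable (I : set (measurableTypeR R)) by exact: measurable_itv.
apply: (@le_lt_trans _ _ (\int[@lebesgue_measure R]_(t in I) (cst (M ^+ 2)%:E t))%E).
  rewrite [leRHS]integral_mkcond; apply: ae_ge0_le_integral => //.
  - by move=> t _; rewrite lee_fin sqr_ge0.
  - by apply/measurable_EFinP; exact: measurable_funX.
  - by move=> t _; rewrite patchE; case: ifP => // _; rewrite lee_fin sqr_ge0.
  - by apply/(measurable_restrictT _ mI); exact: measurable_cst.
  - apply: filterS fM => t /= + _; rewrite !patchE; case: ifPn => [_|_ _]; last first.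
      by rewrite expr0n.
    move=> tM; rewrite lee_fin -[leLHS]real_normK ?num_real// ler_pXn2r ?nnegrE//.
    exact: le_trans tM.
rewrite integral_cst// lte_mul_pinfty// ?lee_fin ?sqr_ge0//.
by rewrite /= lebesgue_measure_itv/=; case: ifP => // _; rewrite ltry.
Qed.

Lemma tensor_in_L2 (f : 'rV[R]_d -> R) (g : R -> R) :
  in_L2 (leb d) Omega f -> in_L2 (@lebesgue_measure R) I g ->
  in_L2 leb_xt Q (fun z => f z.1 * g z.2).
Proof.
move=> /in_L2P[mf foo] /in_L2P[mg goo].
have E : (fun z : Qtype => f z.1 * g z.2) \_ Q =
    fun z => (f \_ Omega) z.1 * (g \_ I) z.2.
  apply/funext => -[x t]; rewrite !restrictE /=.
  have [Ox|nOx] := pselect (Omega x); last first.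
    by rewrite (memNset nOx) mul0r memNset// => -[].
  have [It|nIt] := pselect (I t); last first.
    by rewrite (memNset nIt) mulr0 memNset// => -[].
  by rewrite !mem_set.
have m1 : measurable_fun setT (fun z : Qtype => (f \_ Omega) z.1).
  exact: (measurableT_comp mf measurable_fst).
have m2 : measurable_fun setT (fun z : Qtype => (g \_ I) z.2).
  exact: (measurableT_comp mg measurable_snd).
have mfg : measurable_fun setT ((fun z : Qtype => f z.1 * g z.2) \_ Q).
  by rewrite E; exact: measurable_funM.
apply/in_L2P; split => //.
rewrite fubini_tonelli1; last 2 first.
- by apply/measurable_EFinP; exact: measurable_funX.
- by move=> z; rewrite lee_fin sqr_ge0.
pose G := (\int[@lebesgue_measure R]_t ((g \_ I) t ^+ 2)%:E)%E.
have G0 : (0 <= G)%E by apply: integral_ge0 => t _; rewrite lee_fin sqr_ge0.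
have -> : (\int[leb d]_x fubini_F (@lebesgue_measure R)
    (fun z : Qtype => (((fun z : Qtype => f z.1 * g z.2) \_ Q) z ^+ 2)%:E) x =
    \int[leb d]_x (((f \_ Omega) x ^+ 2)%:E * G))%E.
  apply: eq_integral => x _; rewrite /fubini_F E /=.
  under eq_integral do rewrite exprMn EFinM.
  rewrite ge0_integralZl//.
  - by apply/measurable_EFinP; exact: measurable_funX.
  - by move=> t _; rewrite lee_fin sqr_ge0.
  - by rewrite lee_fin sqr_ge0.
rewrite ge0_integralZr//.
- by rewrite lte_mul_pinfty// ?ge0_fin_numE//; apply: integral_ge0 => x _;
    rewrite lee_fin sqr_ge0.
- by apply/measurable_EFinP; exact: measurable_funX.
- by move=> x _; rewrite lee_fin sqr_ge0.
Qed.

Variables (alpha : R) (mu : R -> R).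
Hypothesis hmu : in_Lp (@lebesgue_measure R) +oo%E I mu.

Lemma weak_formulation_lin a (f : 'rV[R]_d -> R) u b (g : 'rV[R]_d -> R) v :
  in_L2 (leb d) Omega f -> in_L2 (leb d) Omega g ->
  weak_formulation Omega T alpha mu f u ->
  weak_formulation Omega T alpha mu g v ->
  weak_formulation Omega T alpha mu (lin a f b g) (lin a u b v).
Proof.
move=> f2 g2 [u' [Du [cu Du2 uE]]] [v' [Dv [cv Dv2 vE]]].
have [u2 Du_] := Du2; have [v2 Dv_] := Dv2.
have [_ [_ u'2 _]] := cu; have [_ [_ v'2 _]] := cv.
exists (lin a u' b v'), (fun i => lin a (Du i) b (Dv i)); split.
- exact: caputo_lin.
- exact: (L2H1_lin hO).
- move=> phi h phiH phih; have [phi2 h_] := phih.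
  have h2 i : in_L2 leb_xt Q (h i) by case: (h_ i).
  have integrand w' Dw w : in_L2 leb_xt Q w' ->
      (forall i, in_L2 leb_xt Q (Dw i)) -> in_L2 leb_xt Q w ->
      leb_xt.-integrable Q (EFin \o (fun z : Qtype =>
        w' z * phi z + \sum_(i < d) Dw i z * h i z + w z * phi z)).
    move=> w'2 Dw2 w2.
    rewrite (_ : _ \o _ = ((EFin \o (w' \* phi)%R) \+
      (fun z => \sum_(i < d) ((Dw i z * h i z)%:E)) \+ (EFin \o (w \* phi)%R))%E); last first.
      by apply/funext => z /=; rewrite sumEFin -!EFinD.
    apply: integrableD => //; last exact: integrable_mul.
    apply: integrableD => //; first exact: integrable_mul.
    by apply: integrable_sum => // i _; exact: integrable_mul.
  have source (w : 'rV[R]_d -> R) : in_L2 (leb d) Omega w -> leb_xt.-integrable Q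
      (EFin \o (fun z : Qtype => w z.1 * mu z.2 * phi z)).
    move=> w2; apply: (integrable_mul mQ _ phi2).
    by apply: tensor_in_L2 => //; exact: essentially_bounded_in_L2.
  transitivity (\int[leb_xt]_(z in Q) lin
    a (fun z => u' z * phi z + \sum_(i < d) Du i z * h i z + u z * phi z)
    b (fun z => v' z * phi z + \sum_(i < d) Dv i z * h i z + v z * phi z) z).
    apply: eq_Rintegral => z _; rewrite /lin.
    rewrite [X in _ + X + _ = _](_ : _ = a * (\sum_(i < d) Du i z * h i z) +
      b * (\sum_(i < d) Dv i z * h i z)); first by ring.
    by rewrite !mulr_sumr -big_split/=; apply: eq_bigr => i _; ring.
  have Du_2 i : in_L2 leb_xt Q (Du i) by case: (Du_ i).
  have Dv_2 i : in_L2 leb_xt Q (Dv i) by case: (Dv_ i).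
  rewrite (Rintegral_lin mQ _ _ (integrand _ _ _ u'2 Du_2 u2) (integrand _ _ _ v'2 Dv_2 v2)).
  rewrite (uE _ _ phiH phih) (vE _ _ phiH phih).
  rewrite -(Rintegral_lin mQ _ _ (source _ f2) (source _ g2)).
  by apply: eq_Rintegral => z _; rewrite /lin; ring.
Qed.

Lemma is_solution_lin a (f : 'rV[R]_d -> R) u b (g : 'rV[R]_d -> R) v :
  in_L2 (leb d) Omega f -> in_L2 (leb d) Omega g ->
  is_solution Omega T alpha mu f u -> is_solution Omega T alpha mu g v ->
  is_solution Omega T alpha mu (lin a f b g) (lin a u b v).
Proof.
move=> f2 g2 [uH uC [Du [Hu uh]] u0 uE] [vH vC [Dv [Hv vh]] v0 vE]; split.
- exact: zero_Halpha_lin.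
- exact: C_L2_lin.
- exists (fun i => lin a (Du i) b (Dv i)), (fun i j => lin a (Hu i j) b (Hv i j)).
  exact: (L2H2_lin hO).
- apply: ae_imply2 u0 v0 => x /= ux vx Ox.
  by have := ux Ox; have := vx Ox; rewrite /slice /lin => -> ->; rewrite !mulr0 addr0.
- exact: weak_formulation_lin.
Qed.

End solution_linear.

(** * Stability of the minimisers *)

Section L2_convergence.
Context {R : realType} {disp : measure_display} {X : measurableType disp}.
Variables (m : {measure set X -> \bar R}) (D : set X).
Implicit Types (f g h : X -> R).

Lemma L2n_le_add f g h : in_L2 m D f -> in_L2 m D g -> in_L2 m D h ->
  L2n m D (f \- h) <= L2n m D (f \- g) + L2n m D (g \- h).
Proof.
move=> f2 g2 h2.
rewrite (_ : f \- h = lin 1 (f \- g) 1 (g \- h)); last first.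
  by apply/funext => x; rewrite /lin /=; ring.
rewrite -[X in _ <= X + _]mul1r -[X in _ <= _ + X]mul1r -[X in _ <= X * _ + X * _]normr1.
by apply: L2n_lin_le; rewrite linB; exact: in_L2_lin.
Qed.

Lemma L2n_subC f g : L2n m D (f \- g) = L2n m D (g \- f).
Proof.
rewrite /L2n /L2norm; congr fine.
rewrite -[RHS]oppe_Lnorm; apply: eq_Lnorm => x /=.
by rewrite !restrictE; case: ifP => _; rewrite -?EFinN ?oppr0 ?opprB.
Qed.

Lemma cvg_L2n (h_ : nat -> X -> R) h : (forall n, in_L2 m D (h_ n)) ->
  in_L2 m D h -> L2n m D (h_ n \- h) @[n --> \oo] --> (0 : R) ->
  L2n m D (h_ n) @[n --> \oo] --> L2n m D h.
Proof.
move=> h_2 h2 h0.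
have z2 : in_L2 m D (cst 0).
  by rewrite (_ : cst 0 = lin 0 h 0 h); [exact: in_L2_lin|apply/funext => x; rewrite /lin /=; ring].
have subr0_ g : g \- cst 0 = g by apply/funext => x /=; rewrite subr0.
apply: cvg_sub0; last exact: (cvg_cst (L2n m D h)).
apply/norm_cvg0P; apply: squeeze_cvgr h0; last exact: (cvg_cst 0).
apply: nearW => n /=; rewrite normr_ge0/= ler_norml; apply/andP; split.
  rewrite lerBrDr addrC lerBlDr.
  have := L2n_le_add h2 (h_2 n) z2.
  by rewrite !subr0_ L2n_subC addrC.
have := L2n_le_add (h_2 n) h2 z2.
by rewrite !subr0_ lerBlDr.
Qed.

End L2_convergence.

Section Tikhonov.
Context {R : realType} {d : nat}.
Variables (Omega : set 'rV[R]_d) (T : R).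
Hypotheses (hO : convex_polytope_domain Omega) (hT : 0 < T).
Notation Qtype := ('rV[R]_d * measurableTypeR R)%type.
Notation Q := (cylinder T Omega).
Variables (omega : set 'rV[R]_d).
Hypotheses (omega_open : open omega) (omega_sub : omega `<=` Omega).
Notation q := (cylinder T omega).
Variables (alpha : R) (mu : R -> R).
Hypothesis hmu : in_Lp (@lebesgue_measure R) +oo%E `]0, T[ mu.
Hypothesis hwp : well_posed Omega T alpha mu.
Variable beta : R.
Hypothesis hbeta : 0 < beta.
Notation A := (forward Omega T alpha mu).
Notation N := (L2n (leb d) Omega).
Notation M := (L2n leb_xt q).
Implicit Types (f g h : 'rV[R]_d -> R) (v w : Qtype -> R).

Let mO : measurable Omega. Proof. exact: measurable_polytope. Qed.
Let mQ : measurable (Q : set Qtype). Proof. exact: measurable_cylinder. Qed.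
Let mq : measurable (q : set Qtype).
Proof. by apply: measurable_cylinder; exact: open_measurable_rV. Qed.
Let qQ : q `<=` Q. Proof. by move=> z [/omega_sub]. Qed.

Lemma forward_solution f : in_L2 (leb d) Omega f ->
  is_solution Omega T alpha mu f (A f).
Proof. by have [ex _ _] := hwp => /ex uf; exact: (xgetPex (cst 0) uf). Qed.

Lemma forward_in_L2Q f : in_L2 (leb d) Omega f -> in_L2 leb_xt Q (A f).
Proof. by move=> /forward_solution[[[]]]. Qed.

Lemma forward_in_L2 f : in_L2 (leb d) Omega f -> in_L2 leb_xt q (A f).
Proof. by move=> /forward_in_L2Q; exact: in_L2_sub. Qed.

(** Linearity of the equation gives a solution for the combined source, and
    uniqueness identifies it with the chosen one. *)
Lemma forward_lin a f b g : in_L2 (leb d) Omega f -> in_L2 (leb d) Omega g ->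
  ae_eq leb_xt Q (A (lin a f b g)) (lin a (A f) b (A g)).
Proof.
move=> f2 g2; have fg2 := in_L2_lin a b f2 g2.
have [_ uniq _] := hwp; apply: uniq fg2 (forward_solution fg2) _.
by apply: is_solution_lin => //; exact: forward_solution.
Qed.

Lemma Halpha_seminorm2_ge0 (u : Qtype -> R) :
  (0 <= Halpha_seminorm2 Omega T alpha u)%E.
Proof.
apply: integral_ge0 => t _; apply: integral_ge0 => s _.
by apply: mule_ge0; [exact: sqr_L2norm_ge0|rewrite lee_fin powR_ge0].
Qed.

(** The L2 norm is one of the nonnegative terms controlled by the energy
    estimate. *)
Lemma forward_bounded : exists C : R, 0 < C /\ forall f,
  in_L2 (leb d) Omega f -> L2n leb_xt Q (A f) <= C * N f.
Proof.
have [_ _ [C [C0 CP]]] := hwp; exists C; split => // f f2.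
rewrite -lee_fin EFinM -!L2nE//; last exact: forward_in_L2Q.
have uf := forward_solution f2; apply: le_trans (CP f _ f2 uf).
have C_ge0 : (0 <= C_L2_norm Omega T (A f))%E.
  apply: le_trans (L2norm_ge0 (leb d) Omega (slice (A f) 0)) _.
  by apply: ereal_sup_ubound; exists 0 => //=; rewrite in_itv/= lexx ltW.
have H2_ge0 : (0 <= L2H2_norm Omega T (A f))%E.
  by apply: le_ereal_inf_tmp => _ [? [? [_ ->]]]; exact: poweR_ge0.
have H_ge : (L2norm leb_xt Q (A f) <= Halpha_norm Omega T alpha (A f))%E.
  rewrite /Halpha_norm.
  have {1}-> : L2norm leb_xt Q (A f) = ((L2norm leb_xt Q (A f) ^+ 2) `^ 2^-1)%E.
    rewrite (L2nE (forward_in_L2Q f2)) -EFin_expe poweR_EFin.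
    by rewrite -powR_mulrn ?L2n_ge0// -powRrM mulfV// powRr1 ?L2n_ge0.
  apply: gt0_ler_poweR; rewrite ?invr_ge0// ?in_itv/= ?leey ?andbT.
  - exact: sqr_L2norm_ge0.
  - by apply: adde_ge0; [exact: sqr_L2norm_ge0|exact: Halpha_seminorm2_ge0].
  - by rewrite leeDl// Halpha_seminorm2_ge0.
by apply: le_trans H_ge _; rewrite -addeA leeDl// adde_ge0.
Qed.

Definition tikhonov w f : R := M (A f \- w) ^+ 2 + beta * N f ^+ 2.

Lemma JE w f : in_L2 leb_xt q w -> in_L2 (leb d) Omega f ->
  J Omega T alpha mu omega beta w f = (tikhonov w f)%:E.
Proof.
move=> w2 f2; have Afw : in_L2 leb_xt q (A f \- w).
  by rewrite linB; apply: in_L2_lin => //; exact: forward_in_L2.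
by rewrite /J (L2nE Afw) (L2nE f2) -!EFin_expe -EFinM -EFinD.
Qed.

Lemma misfit_midpoint w f g : in_L2 leb_xt q w ->
  in_L2 (leb d) Omega f -> in_L2 (leb d) Omega g ->
  M (A (lin 2^-1 f 2^-1 g) \- w) ^+ 2 <=
  2^-1 * M (A f \- w) ^+ 2 + 2^-1 * M (A g \- w) ^+ 2.
Proof.
move=> w2 f2 g2; have fg2 := in_L2_lin 2^-1 2^-1 f2 g2.
have Af := forward_in_L2 f2; have Ag := forward_in_L2 g2.
have Afg := forward_in_L2 fg2.
have Aw2 (h : Qtype -> R) : in_L2 leb_xt q h -> in_L2 leb_xt q (h \- w).
  by move=> h2; rewrite linB; exact: in_L2_lin.
have -> : M (A (lin 2^-1 f 2^-1 g) \- w) = M (lin 2^-1 (A f \- w) 2^-1 (A g \- w)).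
  congr fine; apply: ae_eq_L2norm => //.
  - apply/(measurable_restrictT _ mq); apply: (in_L2_measurable (m := leb_xt)).
    exact: Aw2.
  - apply/(measurable_restrictT _ mq); apply: (in_L2_measurable (m := leb_xt)).
    by apply: in_L2_lin; exact: Aw2.
  - apply: filterS (forward_lin 2^-1 2^-1 f2 g2) => z /= E qz.
    by rewrite (E (qQ qz)) /lin /=; field.
by rewrite (parallelogram (Aw2 _ Af) (Aw2 _ Ag)) gerBl mulr_ge0 ?sqr_ge0 ?invr_ge0.
Qed.

(** Compare the value at the minimiser with the value at the midpoint of f and g:
    the misfit is convex and the penalty is uniformly convex. *)
Lemma minimizer_strong w f g : in_L2 leb_xt q w ->
  is_minimizer Omega (J Omega T alpha mu omega beta w) f ->
  in_L2 (leb d) Omega g ->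
  beta / 2 * N (f \- g) ^+ 2 <= tikhonov w g - tikhonov w f.
Proof.
move=> w2 [f2 fmin] g2; have fg2 := in_L2_lin 2^-1 2^-1 f2 g2.
have := fmin _ fg2; rewrite !JE// lee_fin /tikhonov.
have := misfit_midpoint w2 f2 g2; rewrite (parallelogram f2 g2).
by nra.
Qed.

Lemma minimizer_misfit w f : in_L2 leb_xt q w ->
  is_minimizer Omega (J Omega T alpha mu omega beta w) f ->
  M (A f \- w) <= M (A (cst 0) \- w).
Proof.
move=> w2 [f2 fmin].
have z2 : in_L2 (leb d) Omega (cst 0).
  by rewrite (_ : cst 0 = lin 0 f 0 f); [exact: in_L2_lin|apply/funext => x; rewrite /lin /=; ring].
have N0 : N (cst 0) = 0.
  apply/eqP; rewrite -sqrf_eq0 -(_ : lin 0 f 0 f = cst 0).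
    by rewrite sqr_L2n_lin// expr0n/= !mul0r mulr0 !mul0r !addr0.
  by apply/funext => x; rewrite /lin /=; ring.
rewrite -(@ler_pXn2r _ 2)// ?nnegrE ?L2n_ge0//.
have := fmin _ z2; rewrite !JE// lee_fin /tikhonov N0 expr0n/= mulr0 addr0.
by apply: le_trans; rewrite lerDl mulr_ge0 ?sqr_ge0// ltW.
Qed.

(** The two strong convexity inequalities are added; what remains are the changes
    of the two misfits when one datum replaces the other, each a difference of
    squares of norms that differ by at most M (w - v). *)
Lemma minimizer_stability w v f g : in_L2 leb_xt q w -> in_L2 leb_xt q v ->
  is_minimizer Omega (J Omega T alpha mu omega beta w) f ->
  is_minimizer Omega (J Omega T alpha mu omega beta v) g ->
  beta * N (f \- g) ^+ 2 <= 2 * M (w \- v) *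
    (M (A (cst 0) \- w) + M (A (cst 0) \- v) + M (w \- v)).
Proof.
move=> w2 v2 fmin gmin; have [f2 _] := fmin; have [g2 _] := gmin.
have := minimizer_strong w2 fmin g2; have := minimizer_strong v2 gmin f2.
rewrite (L2n_subC _ _ g f) /tikhonov.
have := minimizer_misfit w2 fmin; have := minimizer_misfit v2 gmin.
have := L2n_le_add (forward_in_L2 f2) w2 v2.
have := L2n_le_add (forward_in_L2 g2) v2 w2.
rewrite (L2n_subC _ _ v w).
have := L2n_ge0 leb_xt q (w \- v); have := L2n_ge0 leb_xt q (A f \- w).
have := L2n_ge0 leb_xt q (A g \- v).
have := L2n_ge0 leb_xt q (A f \- v); have := L2n_ge0 leb_xt q (A g \- w).
move: (N (f \- g)) (N f) (N g) => n nf ng.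
move: (M (w \- v)) (M (A f \- w)) (M (A f \- v)) (M (A g \- w)) (M (A g \- v)).
move: (M _) (M _) => kw kv e fw fv gw gv gw0 fv0 gv0 fw0 e0 h1 h2 h3 h4 h5 h6.
have h7 : gw ^+ 2 <= (gv + e) ^+ 2 by rewrite ler_pXn2r ?nnegrE ?addr_ge0.
have h8 : fv ^+ 2 <= (fw + e) ^+ 2 by rewrite ler_pXn2r ?nnegrE ?addr_ge0.
have h9 : e * gv <= e * kv by rewrite ler_wpM2l.
have h10 : e * fw <= e * kw by rewrite ler_wpM2l.
by nra.
Qed.

Section convergence.
Variables (ud : Qtype -> R) (v : nat -> Qtype -> R) (F : nat -> 'rV[R]_d -> R).
Hypotheses (ud2 : in_L2 leb_xt q ud) (v2 : forall n, in_L2 leb_xt q (v n)).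
Hypothesis (vud : M (v n \- ud) @[n --> \oo] --> (0 : R)).
Hypothesis Fmin : forall n,
  is_minimizer Omega (J Omega T alpha mu omega beta (v n)) (F n).

Let F2 n : in_L2 (leb d) Omega (F n). Proof. by have [] := Fmin n. Qed.

Let z2 : in_L2 (leb d) Omega (cst 0).
Proof.
rewrite (_ : cst 0 = lin 0 (F 0%N) 0 (F 0%N)); first exact: in_L2_lin.
by apply/funext => x; rewrite /lin /=; ring.
Qed.

(** Along the sequence the misfits M (A 0 - v_n) stay bounded, so the right-hand
    side of the stability estimate is of the order of M (v_i - v_j). *)
Lemma minimizers_Cauchy e : 0 < e -> exists n, forall i j,
  (n <= i)%N -> (n <= j)%N -> N (F i \- F j) <= e.
Proof.
move=> e0; pose K := M (A (cst 0) \- ud).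
have K0 : 0 <= K by exact: L2n_ge0.
(* eta <= 1 bounds the misfits at 0 by K + 1, and the other bound makes the
   right-hand side of the stability estimate at most beta e^2 *)
pose eta := Num.min 1 (beta * e ^+ 2 / (8 * (K + 2))).
have eta0 : 0 < eta.
  by rewrite lt_min ltr01/= divr_gt0 ?mulr_gt0 ?exprn_gt0// ltr_wpDl.
have eta1 : eta <= 1 by rewrite ge_min lexx.
have etaK : 8 * eta * (K + 2) <= beta * e ^+ 2.
  have : eta <= beta * e ^+ 2 / (8 * (K + 2)) by rewrite ge_min lexx orbT.
  by rewrite ler_pdivlMr ?mulr_gt0// ?ltr_wpDl// mulrA (mulrC eta).
have [n _ nP] : \forall n \near \oo, M (v n \- ud) <= eta.
  have /cvgr0Pnorm_le/(_ _ eta0) := vud.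
  by apply: filterS => n; rewrite ger0_norm// L2n_ge0.
exists n => i j ni nj.
rewrite -(@ler_pXn2r _ 2)// ?nnegrE ?L2n_ge0 ?(ltW e0)// -(ler_pM2l hbeta).
apply: le_trans (minimizer_stability (v2 i) (v2 j) (Fmin i) (Fmin j)) _.
apply: le_trans etaK.
have := L2n_le_add (forward_in_L2 z2) ud2 (v2 i).
have := L2n_le_add (forward_in_L2 z2) ud2 (v2 j).
have := L2n_le_add (v2 i) ud2 (v2 j).
rewrite (L2n_subC _ _ ud (v i)) (L2n_subC _ _ ud (v j)) -/K.
have := nP i ni; have := nP j nj; rewrite /=.
have := L2n_ge0 leb_xt q (v i \- v j).
have := L2n_ge0 leb_xt q (A (cst 0) \- v i).
have := L2n_ge0 leb_xt q (A (cst 0) \- v j).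
move: (M (v i \- v j)) (M (v i \- ud)) (M (v j \- ud)).
move: (M (_ \- v i)) (M (_ \- v j)) => ki kj E di dj kj0 ki0 E0 dje die h1 h2 h3.
have : E * (ki + kj + E) <= (2 * eta) * (2 * K + 4).
  by apply: ler_pM => //; lra.
by lra.
Qed.

Lemma minimizers_cvg : exists f, in_L2 (leb d) Omega f /\
  N (F n \- f) @[n --> \oo] --> (0 : R).
Proof.
(* completeness is applied on the whole space, to the extensions by 0 *)
pose G n := F n \_ Omega.
have GB i j : L2n (leb d) setT (G i \- G j) = N (F i \- F j).
  congr fine; rewrite /L2norm patch_setT; apply: eq_Lnorm => x /=.
  by rewrite /G !restrictE; case: ifP => // _; rewrite subr0.
have G2 n : in_L2 (leb d) setT (G n).
  by have := F2 n; rewrite /in_L2 /in_Lp patch_setT.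
have [e e0|f [f2 fP]] := L2_complete G2.
  have [n nP] := minimizers_Cauchy e0.
  by exists n => i j ni nj; rewrite GB; exact: nP.
have fO : in_L2 (leb d) Omega f by exact: in_L2_sub f2.
exists f; split => //; apply/cvgr0Pnorm_le => e e0.
have [n nP] := fP e e0; exists n => // i ni /=.
rewrite ger0_norm ?L2n_ge0//; apply: le_trans (nP i ni).
have -> : N (F i \- f) = N (G i \- f).
  congr fine; apply: eq_Lnorm => x /=.
  by rewrite /G !restrictE /= restrictE; case: (x \in Omega).
apply: le_L2n_sub => //.
by rewrite linB; exact: in_L2_lin.
Qed.

(** Both sides of J_(v_n)(f_n) <= J_(v_n)(g) converge: A f_n tends to A f by the
    energy estimate, and v_n tends to ud. *)
Lemma limit_is_minimizer f : in_L2 (leb d) Omega f ->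
  N (F n \- f) @[n --> \oo] --> (0 : R) ->
  is_minimizer Omega (J Omega T alpha mu omega beta ud) f.
Proof.
move=> f2 Ff; split => // g g2; rewrite !JE// lee_fin.
have [C [C0 CP]] := forward_bounded.
have Mq (h : Qtype -> R) : in_L2 leb_xt Q h -> M h <= L2n leb_xt Q h.
  by move=> h2; exact: le_L2n_sub.
have AB h k : in_L2 (leb d) Omega h -> in_L2 (leb d) Omega k ->
    M (A h \- A k) <= C * N (h \- k).
  move=> h2 k2; have hk2 : in_L2 (leb d) Omega (h \- k).
    by rewrite linB; exact: in_L2_lin.
  apply: le_trans (CP _ hk2).
  have -> : M (A h \- A k) = M (A (h \- k)).
    congr fine; apply: ae_eq_L2norm => //.
    - apply/(measurable_restrictT _ mq); apply: (in_L2_measurable (m := leb_xt)).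
      by rewrite linB; apply: in_L2_lin; exact: forward_in_L2.
    - apply/(measurable_restrictT _ mq); apply: (in_L2_measurable (m := leb_xt)).
      exact: forward_in_L2.
    - apply: filterS (forward_lin 1 (-1) h2 k2) => z /= E qz.
      by rewrite [in RHS](linB h k) (E (qQ qz)) /lin mul1r mulN1r.
  by apply: Mq; exact: forward_in_L2Q.
have sub2 h w : in_L2 (leb d) Omega h -> in_L2 leb_xt q w -> in_L2 leb_xt q (A h \- w).
  by move=> h2 w2; rewrite linB; apply: in_L2_lin => //; exact: forward_in_L2.
have cl : M (A (F n) \- v n) @[n --> \oo] --> M (A f \- ud).
  apply: cvg_L2n => [n||]; [exact: sub2|exact: sub2|].
  apply: (@squeeze_cvgr _ _ _ _ (cst 0) (fun n => C * N (F n \- f) + M (v n \- ud))).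
  - apply: nearW => n; rewrite L2n_ge0/=.
    apply: le_trans (lerD (AB _ _ (F2 n) f2) (lexx _)).
    rewrite (L2n_subC _ _ (v n)).
    rewrite (_ : (A (F n) \- v n) \- (A f \- ud) = lin 1 (A (F n) \- A f) 1 (ud \- v n)); last first.
      by apply/funext => x; rewrite /lin /=; ring.
    rewrite -[X in _ <= X + _]mul1r -[X in _ <= _ + X]mul1r -[X in _ <= X * _ + X * _]normr1.
    apply: L2n_lin_le; rewrite linB; apply: in_L2_lin => //; exact: forward_in_L2.
  - exact: cvg_cst.
  - rewrite -[0](_ : C * 0 + 0 = 0); last by rewrite mulr0 addr0.
    by apply: cvgD => //; apply: cvgMr.
have cN : N (F n) @[n --> \oo] --> N f by exact: cvg_L2n.
have cr : M (A g \- v n) @[n --> \oo] --> M (A g \- ud).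
  apply: cvg_L2n => [n||]; [exact: sub2|exact: sub2|].
  rewrite (_ : (fun n => _) = fun n => M (v n \- ud))//.
  apply/funext => n; rewrite L2n_subC; congr (M _).
  by apply/funext => z /=; ring.
have sq (u : nat -> R) (l : R) : u n @[n --> \oo] --> l -> u n ^+ 2 @[n --> \oo] --> l ^+ 2.
  by move=> ul; exact: (cvgM ul ul).
have cf : tikhonov (v n) (F n) @[n --> \oo] --> tikhonov ud f.
  by apply: cvgD; [exact: sq|apply: cvgMr; exact: sq].
have cg : tikhonov (v n) g @[n --> \oo] --> tikhonov ud g.
  by apply: cvgD; [exact: sq|exact: cvg_cst].
apply: (ler_cvg_to cf cg); apply: nearW => n.
by have [_ /(_ _ g2)] := Fmin n; rewrite !JE// lee_fin.
Qed.

End convergence.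

Lemma minimizer_unique w f g : in_L2 leb_xt q w ->
  is_minimizer Omega (J Omega T alpha mu omega beta w) f ->
  is_minimizer Omega (J Omega T alpha mu omega beta w) g ->
  ae_eq (leb d) Omega g f.
Proof.
move=> w2 fmin gmin; have [f2 fP] := fmin; have [g2 gP] := gmin.
apply: L2norm_eq0 => //; rewrite L2nE; last by rewrite linB; exact: in_L2_lin.
congr EFin; apply/eqP; rewrite -sqrf_eq0 eq_le sqr_ge0 andbT L2n_subC.
have := minimizer_strong w2 fmin g2.
have := gP _ f2; rewrite !JE// lee_fin => h1 h2.
rewrite -(@pmulr_rle0 _ (beta / 2)) ?divr_gt0//.
by apply: le_trans h2 _; rewrite subr_le0.
Qed.

End Tikhonov.

Unset Implicit Arguments.

Theorem theorem2p2 (R : realType) (d : nat) (hd : (0 < d <= 3)%N)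
    (T : R) (hT : 0 < T)
    (Omega : set 'rV[R]_d) (hOmega : convex_polytope_domain Omega)
    (omega : set 'rV[R]_d) (homega0 : omega !=set0) (homega_open : open omega)
    (homega_conn : connected omega) (homega_sub : omega `<=` Omega)
    (alpha : R) (halpha : 0 < alpha < 1)
    (mu : R -> R) (hmu : in_Lp (@lebesgue_measure R) +oo%E `]0, T[ mu)
    (hwp : well_posed Omega T alpha mu)
    (beta : R) (hbeta : 0 < beta)
    (ud : 'rV[R]_d * measurableTypeR R -> R)
    (hud : in_L2 leb_xt (cylinder T omega) ud)
    (udl : nat -> 'rV[R]_d * measurableTypeR R -> R)
    (hudl : forall l, (1 <= l)%N -> in_L2 leb_xt (cylinder T omega) (udl l))
    (hconv : L2norm leb_xt (cylinder T omega) (udl l \- ud) @[l --> \oo] --> 0%E)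
    (fl : nat -> 'rV[R]_d -> R)
    (hfl : forall l, (1 <= l)%N ->
      is_minimizer Omega (J Omega T alpha mu omega beta (udl l)) (fl l)) :
  exists f : 'rV[R]_d -> R,
    [/\ is_minimizer Omega (J Omega T alpha mu omega beta ud) f,
        (forall g, is_minimizer Omega (J Omega T alpha mu omega beta ud) g ->
           ae_eq (leb d) Omega g f) &
        L2norm (leb d) Omega (fl l \- f) @[l --> \oo] --> 0%E].
Proof.
(* the hypotheses start at index 1 *)
pose v n := udl n.+1; pose F n := fl n.+1.
have v2 n : in_L2 leb_xt (cylinder T omega) (v n) by exact: hudl.
have Fmin n : is_minimizer Omega (J Omega T alpha mu omega beta (v n)) (F n).
  exact: hfl.
have F2 n : in_L2 (leb d) Omega (F n) by have [] := Fmin n.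
have vud : L2n leb_xt (cylinder T omega) (v n \- ud) @[n --> \oo] --> (0 : R).
  by apply: (@fine_cvg _ _ _ _ _ 0); rewrite (cvg_shiftS (fun l => L2norm _ _ (udl l \- ud))).
have [f [f2 Ff]] := minimizers_cvg hOmega homega_open homega_sub hmu hwp hbeta hud v2 vud Fmin.
have fmin := limit_is_minimizer hOmega hT homega_open homega_sub hmu hwp hud v2 vud Fmin f2 Ff.
exists f; split => //.
  by move=> g; exact: (minimizer_unique hOmega homega_open homega_sub hmu hwp hbeta hud fmin).
rewrite -(cvg_shiftS (fun l => L2norm _ _ (fl l \- f))).
rewrite (_ : (fun n => _) = fun n => (L2n (leb d) Omega (F n \- f))%:E).
  by apply: cvg_EFin; [exact: nearW|exact: Ff].
apply/funext => n; apply: L2nE; rewrite linB.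
exact: (in_L2_lin 1 (-1) (F2 n) f2).
Qed.
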